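(* The theory of the structure $(\mathbb{R}, \exp_{\restriction [0,1]})$ (the ordered field of reals expanded by the exponential function restricted to $[0,1]$) does not admit generic derivations.
   Context: For a theory $T$ in a language $L$ expanding rings: $T_M$ is its Morleyization (a new relation symbol for each $L$-formula), and $T_M^\delta$ is $T_M$ together with a new unary function symbol $\delta$ and axioms $\delta(x+y)=\delta x+\delta y$, $\delta(xy)=x\,\delta y+y\,\delta x$. $T$ admits generic derivations if $T_M^\delta$ has a model companion, i.e. the class of existentially closed models of $T_M^\delta$ is elementary. *)

(* Defs.v *)
From mathcomp Require Import all_boot.
From Stdlib Require Import Reals.

Set Implicit Arguments.
Unset Strict Implicit.
Unset Printing Implicit Defensive.

Record signature := Signature {
  fsym : Type; farity : fsym -> nat;
  rsym : Type; rarity : rsym -> nat }.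

Section FO.
Variable L : signature.

Inductive term : Type :=
| Var : nat -> term
| App : forall f : fsym L, ('I_(farity f) -> term) -> term.

Inductive formula : Type :=
| Eq  : term -> term -> formula
| Rel : forall r : rsym L, ('I_(rarity r) -> term) -> formula
| Fal : formula
| Neg : formula -> formula
| And : formula -> formula -> formula
| Or  : formula -> formula -> formula
| Imp : formula -> formula -> formula
| Ex  : nat -> formula -> formula
| All : nat -> formula -> formula.

Definition Iff (a b : formula) : formula := And (Imp a b) (Imp b a).

Fixpoint tfv (t : term) : seq nat :=
  match t with
  | Var n => [:: n]
  | App f a => flatten [seq tfv (a i) | i <- enum 'I_(farity f)]
  end.

Fixpoint ffv (p : formula) : seq nat :=
  match p with
  | Eq t u => tfv t ++ tfv u
  | Rel r a => flatten [seq tfv (a i) | i <- enum 'I_(rarity r)]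
  | Fal => [::]
  | Neg q => ffv q
  | And q1 q2 | Or q1 q2 | Imp q1 q2 => ffv q1 ++ ffv q2
  | Ex v q | All v q => [seq x <- ffv q | x != v]
  end.

Definition fvbound (p : formula) : nat := foldr (fun x m => maxn x.+1 m) 0 (ffv p).

Fixpoint qf (p : formula) : bool :=
  match p with
  | Ex _ _ | All _ _ => false
  | Neg q => qf q
  | And q1 q2 | Or q1 q2 | Imp q1 q2 => qf q1 && qf q2
  | _ => true
  end.

Fixpoint existential (p : formula) : bool :=
  match p with
  | Ex _ q => existential q
  | _ => qf p
  end.

Record structure := Structure {
  carrier :> Type;
  ifun : forall f : fsym L, ('I_(farity f) -> carrier) -> carrier;
  irel : forall r : rsym L, ('I_(rarity r) -> carrier) -> Prop }.

Section Sem.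
Variable M : structure.

Fixpoint eval (s : nat -> M) (t : term) : M :=
  match t with
  | Var n => s n
  | App f a => @ifun M f (fun i => eval s (a i))
  end.

Definition update (s : nat -> M) (v : nat) (x : M) : nat -> M :=
  fun n => if n == v then x else s n.

Fixpoint sat (s : nat -> M) (p : formula) : Prop :=
  match p with
  | Eq t u => eval s t = eval s u
  | Rel r a => @irel M r (fun i => eval s (a i))
  | Fal => False
  | Neg q => ~ sat s q
  | And q1 q2 => sat s q1 /\ sat s q2
  | Or q1 q2 => sat s q1 \/ sat s q2
  | Imp q1 q2 => sat s q1 -> sat s q2
  | Ex v q => exists x : M, sat (update s v x) q
  | All v q => forall x : M, sat (update s v x) q
  end.

Definition holds (p : formula) : Prop := forall s : nat -> M, sat s p.

Definition models (T : formula -> Prop) : Prop := forall p, T p -> holds p.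
End Sem.

Definition Th (M : structure) : formula -> Prop := fun p => holds M p.

Definition embedding (M N : structure) (h : M -> N) : Prop :=
  injective h /\
  (forall f (a : 'I_(farity f) -> M), h (@ifun M f a) = @ifun N f (fun i => h (a i))) /\
  (forall r (a : 'I_(rarity r) -> M), @irel M r a <-> @irel N r (fun i => h (a i))).

Definition ec_model (T : formula -> Prop) (M : structure) : Prop :=
  models M T /\
  forall (N : structure) (h : M -> N), embedding h -> models N T ->
  forall (p : formula) (s : nat -> M), existential p ->
    sat (fun n => h (s n)) p -> sat s p.

(* a class of L-structures is elementary: axiomatized by a set of formulas
   (equivalently, of their universal closures, i.e. of sentences) *)
Definition elementary (K : structure -> Prop) : Prop :=
  exists Sigma : formula -> Prop, forall M : structure, K M <-> models M Sigma.

End FO.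

Arguments Var {L}.

Definition sigMd (L : signature) : signature :=
  Signature
    (fun f : option (fsym L) => match f with Some g => farity g | None => 1 end)
    (fun r : (rsym L + formula L)%type =>
       match r with inl r0 => rarity r0 | inr p => fvbound p end).

Fixpoint temb (L : signature) (t : term L) : term (sigMd L) :=
  match t with
  | Var n => Var n
  | App f a => @App (sigMd L) (Some f) (fun i => temb (a i))
  end.

Fixpoint femb (L : signature) (p : formula L) : formula (sigMd L) :=
  match p with
  | Eq t u => Eq (temb t) (temb u)
  | Rel r a => @Rel (sigMd L) (inl r) (fun i => temb (a i))
  | Fal => Fal _
  | Neg q => Neg (femb q)
  | And q1 q2 => And (femb q1) (femb q2)
  | Or q1 q2 => Or (femb q1) (femb q2)
  | Imp q1 q2 => Imp (femb q1) (femb q2)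
  | Ex v q => Ex v (femb q)
  | All v q => All v (femb q)
  end.

Section Delta.
Variables (L : signature) (add mul : fsym L).

Definition dlt (t : term (sigMd L)) : term (sigMd L) :=
  @App (sigMd L) None (fun _ => t).
Definition bin (f : fsym L) (t u : term (sigMd L)) : term (sigMd L) :=
  @App (sigMd L) (Some f) (fun i => if nat_of_ord i == 0 then t else u).

Definition ax_add : formula (sigMd L) :=
  Eq (dlt (bin add (Var 0) (Var 1))) (bin add (dlt (Var 0)) (dlt (Var 1))).
Definition ax_mul : formula (sigMd L) :=
  Eq (dlt (bin mul (Var 0) (Var 1)))
     (bin add (bin mul (Var 0) (dlt (Var 1))) (bin mul (Var 1) (dlt (Var 0)))).

Definition morley_ax (p : formula L) : formula (sigMd L) :=
  Iff (@Rel (sigMd L) (inr p) (fun i => Var (nat_of_ord i))) (femb p).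

Definition TMd (T : formula L -> Prop) : formula (sigMd L) -> Prop :=
  fun q => (exists p, T p /\ q = femb p) \/
           (exists p, q = morley_ax p) \/
           q = ax_add \/ q = ax_mul.

Definition admits_generic_derivations (T : formula L -> Prop) : Prop :=
  elementary (ec_model (TMd T)).
End Delta.

Inductive Lexp_fun := Fzero | Fone | Fadd | Fneg | Fmul | Fexp.
Inductive Lexp_rel := Flt.

Definition Lexp : signature :=
  Signature
    (fun f : Lexp_fun => match f with
       | Fzero | Fone => 0 | Fneg | Fexp => 1 | Fadd | Fmul => 2 end)
    (fun _ : Lexp_rel => 2).

Definition exp01 (x : R) : R :=
  if Rle_dec 0 x then if Rle_dec x 1 then exp x else 0%R else 0%R.

Definition i0 {n} : 'I_n.+1 := @Ordinal n.+1 0 isT.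
Definition i1 {n} : 'I_n.+2 := @Ordinal n.+2 1 isT.

Definition Rexp_struct : structure Lexp :=
  @Structure Lexp R
    (fun f => match f return ('I_(@farity Lexp f) -> R) -> R with
       | Fzero => fun _ => 0%R
       | Fone => fun _ => 1%R
       | Fadd => fun a => (a i0 + a i1)%R
       | Fneg => fun a => (- a i0)%R
       | Fmul => fun a => (a i0 * a i1)%R
       | Fexp => fun a => exp01 (a i0)
       end)
    (fun r => match r return ('I_(@rarity Lexp r) -> R) -> Prop with
       | Flt => fun a => (a i0 < a i1)%R end).

(* Main.v *)
Require Import Defs.
From mathcomp Require Import all_boot.
From Stdlib Require Import Reals Lra.
From HB Require Import structures.
From mathcomp Require Import all_order all_algebra ring zify.
From mathcomp Require Import boolp classical_sets filter.

(** Let splits(c) say that some t satisfies delta (exp (c t)) = 0 and delta (exp t) = 1. In every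
    model of the theory with a derivation this fails for c = 1 / n, because exp t is then 0 or the
    n-th power of exp (c t). Suppose that the existentially closed models form an elementary class,
    let M be one of them, N a nonprincipal ultrapower of M indexed by the naturals, and c the class
    of the sequence 1 / (n + 1). Then N is existentially closed. No nonzero polynomial P(X, Y) over
    N satisfies P(exp (c t), exp t) = 0 for all t: over the reals and for c = 1 / n with n large
    compared to the degree, Kronecker's substitution turns P into a nonzero polynomial with
    infinitely many roots. So an ultrapower of N has a point t for which exp (c t) and exp t are
    algebraically independent over N. The derivation of N extends to this ultrapower with values
    0 and 1 there; hence splits(c) holds in the extension, thus in N, and by Los's theorem
    splits(1 / (n + 1)) holds in M for some n, a contradiction. The existentially closed model M is
    obtained by finite forcing inside an ultraproduct. *)

Set Implicit Arguments.
Unset Strict Implicit.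
Unset Printing Implicit Defensive.

Local Open Scope classical_set_scope.

(** * Satisfaction and free variables *)

Section Extensionality.
Variables (L : signature) (M : structure L).

Lemma eval_ext (t : term L) (s s' : nat -> M) :
  (forall n, n \in tfv t -> s n = s' n) -> eval s t = eval s' t.
Proof.
elim: t => [n|f a IH] /= ss'; first by apply: ss'; rewrite inE.
congr ifun; apply: funext => i; apply: IH => n na; apply: ss'.
by apply/flattenP; exists (tfv (a i)) => //; apply/map_f/mem_enum.
Qed.

Lemma sat_ext (p : formula L) (s s' : nat -> M) :
  (forall n, n \in ffv p -> s n = s' n) -> sat s p <-> sat s' p.
Proof.
elim: p s s' => [t u|r a||q IH|q IHq r IHr|q IHq r IHr|q IHq r IHr|v q IH|v q IH] s s' /= ss'.
- rewrite (@eval_ext t s s') ?(@eval_ext u s s') // => n nt; apply: ss';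
  by rewrite mem_cat nt ?orbT.
- suff -> : (fun i => eval s (a i)) = (fun i => eval s' (a i)) by [].
  apply: funext => i; apply: eval_ext => n na; apply: ss'.
  by apply/flattenP; exists (tfv (a i)) => //; apply/map_f/mem_enum.
- by [].
- by have := IH s s' ss'; tauto.
- by rewrite (IHq s s') ?(IHr s s') // => n nq; apply: ss'; rewrite mem_cat nq ?orbT.
- by rewrite (IHq s s') ?(IHr s s') // => n nq; apply: ss'; rewrite mem_cat nq ?orbT.
- by rewrite (IHq s s') ?(IHr s s') // => n nq; apply: ss'; rewrite mem_cat nq ?orbT.
- have E x : sat (update s v x) q <-> sat (update s' v x) q.
    apply: IH => n nq; rewrite /update; case: eqP => // /eqP nv.
    by apply: ss'; rewrite mem_filter nv.
  by split=> -[x /E]; exists x.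
- have E x : sat (update s v x) q <-> sat (update s' v x) q.
    apply: IH => n nq; rewrite /update; case: eqP => // /eqP nv.
    by apply: ss'; rewrite mem_filter nv.
  by split=> H x; apply/E.
Qed.

End Extensionality.

(** * Ultraproducts *)

Section Ultraproduct.
Variables (L : signature) (I : Type) (U : set_system I) (UU : UltraFilter U).
Variable N : I -> structure L.

Definition upclass (f : forall i, N i) : set (forall i, N i) :=
  [set g | U [set i | f i = g i]].

(** Points are the equivalence classes themselves, as sets of functions, so that the Leibniz
    equality by which [sat] interprets [Eq] is equality almost everywhere. *)
Definition upcar : Type := {C : set (forall i, N i) | exists f, C = upclass f}.

Definition cls (f : forall i, N i) : upcar :=
  exist _ (upclass f) (ex_intro _ f erefl).

Definition rep (C : upcar) : forall i, N i := sval (cid (svalP C)).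

Lemma upcar_inj (C D : upcar) : sval C = sval D -> C = D.
Proof.
case: C D => [C hC] [D hD] /= CD; case: _ / CD hD => hD.
by congr exist; apply: Prop_irrelevance.
Qed.

Lemma clsP (f g : forall i, N i) : cls f = cls g <-> U [set i | f i = g i].
Proof.
split=> [/(congr1 sval)/= fg|Ufg].
  have : upclass g g by rewrite /upclass/=; apply: filterS filterT.
  by rewrite -fg.
apply: upcar_inj; apply/predeqP => h; split=> /= Uh.
  by apply: filterS (filterI Ufg Uh) => i /= [<-].
by apply: filterS (filterI Ufg Uh) => i /= [->].
Qed.

Lemma repK (C : upcar) : cls (rep C) = C.
Proof. by apply: upcar_inj => /=; rewrite /rep; case: (cid _). Qed.

(** Symbols are interpreted on chosen representatives; [ifun_up] and [irel_up] show that the choice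
    does not matter. *)
Definition up : structure L := @Structure L upcar
  (fun f a => cls (fun i => @ifun L (N i) f (fun k => rep (a k) i)))
  (fun r a => U [set i | @irel L (N i) r (fun k => rep (a k) i)]).

(** Arities are finite and a filter is closed under finite intersections, so one set of [U] serves
    all arguments at once. *)
Lemma rep_cls n (a : 'I_n -> forall i, N i) :
  U [set i | (fun k => rep (cls (a k)) i) = (fun k => a k i)].
Proof.
have /(@filter_forall _ _ _ U) H : forall k, U [set i | rep (cls (a k)) i = a k i].
  by move=> k; apply/clsP; rewrite repK.
by apply: filterS H => i /= H; apply: funext.
Qed.

Lemma ifun_up (f : Defs.fsym L) (a : 'I_(farity f) -> forall i, N i) :
  @ifun L up f (fun k => cls (a k)) = cls (fun i => @ifun L (N i) f (fun k => a k i)).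
Proof. by apply/clsP; apply: filterS (rep_cls a) => i /= ->. Qed.

Lemma irel_up (r : rsym L) (a : 'I_(rarity r) -> forall i, N i) :
  @irel L up r (fun k => cls (a k)) <-> U [set i | @irel L (N i) r (fun k => a k i)].
Proof.
by split=> H; apply: filterS (filterI H (rep_cls a)) => i /= [+ E]; rewrite E.
Qed.

Lemma eval_up (s : nat -> forall i, N i) (t : term L) :
  eval (fun n => cls (s n) : up) t = cls (fun i => eval (fun n => s n i) t).
Proof.
elim: t => [//|f a IH].
transitivity (@ifun L up f (fun k => cls (fun i => eval (fun n => s n i) (a k)))).
  by congr (@ifun L up f); apply: funext => k; exact: IH.
exact: ifun_up.
Qed.

Lemma update_cls (s : nat -> forall i, N i) v (g : forall i, N i) :
  update (fun n => cls (s n) : up) v (cls g) =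
  (fun n => cls (fun i => update (fun n => s n i) v (g i) n)).
Proof. by apply: funext => n; rewrite /update; case: eqP. Qed.

Lemma ultraC (A : set I) : U (~` A) <-> ~ U A.
Proof.
split=> [UC UA|nUA]; last by case: (in_ultra_setVsetC A UU).
by have [i []] := filter_ex (filterI UC UA).
Qed.

Theorem los (p : formula L) (s : nat -> forall i, N i) :
  sat (fun n => cls (s n) : up) p <-> U [set i | sat (fun n => s n i) p].
Proof.
elim: p s => [t u|r a||q IH|q IHq r IHr|q IHq r IHr|q IHq r IHr|v q IH|v q IH] s.
- by rewrite /= !eval_up clsP.
- rewrite -[_ _ (Rel _)]/(@irel L up r (fun k => eval (fun n => cls (s n) : up) (a k))).
  suff -> : (fun k => eval (fun n => cls (s n) : up) (a k)) =
     (fun k => cls (fun i => eval (fun n => s n i) (a k))) by exact: irel_up.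
  by apply: funext => k; exact: eval_up.
- by split=> //= H; have [] := filter_ex H.
- by rewrite /= IH; split=> /ultraC.
- rewrite /= IHq IHr; split=> [[Hq Hr]|H]; first exact: filterI.
  by split; apply: filterS H => i [].
- rewrite /= IHq IHr; split=> [[]|H].
  + by apply: filterS => i; left.
  + by apply: filterS => i; right.
  + case: (in_ultra_setVsetC [set i | sat (fun n => s n i) q] UU) => Hq; [by left|right].
    by apply: filterS (filterI H Hq) => i /= [[]].
- rewrite /= IHq IHr; split=> [H|H Hq]; last first.
    by apply: filterS (filterI H Hq) => i /= [Hqr /Hqr].
  case: (in_ultra_setVsetC [set i | sat (fun n => s n i) q] UU) => [/H|].
    by apply: filterS => i /= + _.
  by apply: filterS => i /= nq /nq.
- split=> /= [[x]|H].
    rewrite -(repK x) update_cls IH; apply: filterS => i /= H.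
    by exists (rep x i).
  have [g gP] : exists g : forall i, N i, forall i,
      (exists x, sat (update (fun n => s n i) v x) q) ->
      sat (update (fun n => s n i) v (g i)) q.
    have X i : {g : N i | (exists x, sat (update (fun n => s n i) v x) q) ->
      sat (update (fun n => s n i) v g) q}.
      apply: cid; case: (pselect (exists x, sat (update (fun n => s n i) v x) q)).
        by case=> x Hx; exists x.
      (* At an index without a witness any point will do; [s 0 i] shows that the factor is
         inhabited. *)
      by move=> nx; exists (s 0 i).
    by exists (fun i => sval (X i)) => i; case: (X i).
  by exists (cls g); rewrite update_cls IH; apply: filterS H => i /= /gP.
- split=> /= [H|H x]; last first.
    by rewrite -(repK x) update_cls IH; apply: filterS H => i /=; exact.
  (* If the universal statement failed on a set of [U], the class of a function choosing
     counterexamples would refute it in the ultraproduct. *)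
  case: (in_ultra_setVsetC [set i | forall x, sat (update (fun n => s n i) v x) q] UU) => // nH.
  have [g gP] : exists g : forall i, N i, forall i,
      ~ (forall x, sat (update (fun n => s n i) v x) q) ->
      ~ sat (update (fun n => s n i) v (g i)) q.
    have X i : {g : N i | ~ (forall x, sat (update (fun n => s n i) v x) q) ->
      ~ sat (update (fun n => s n i) v g) q}.
      apply: cid; case: (pselect (exists x, ~ sat (update (fun n => s n i) v x) q)).
        by case=> x Hx; exists x.
      by move/forallNP => nx; exists (s 0 i) => + _; apply => x; apply: contrapT.
    by exists (fun i => sval (X i)) => i; case: (X i).
  have := H (cls g); rewrite update_cls IH => Hg.
  by have [i [/= + /gP]] := filter_ex (filterI Hg nH).
Qed.

Lemma up_models (T : formula L -> Prop) : (forall i, models (N i) T) -> models up T.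
Proof.
move=> NT p Tp s.
have -> : s = (fun n => cls (rep (s n))) by apply: funext => n; rewrite repK.
by apply/los; apply: filterS filterT => i _; exact: NT.
Qed.

End Ultraproduct.

Lemma mem_fvbound (L : signature) (p : formula L) n : n \in ffv p -> n < fvbound p.
Proof.
rewrite /fvbound; elim: (ffv p) => //= x s IH; rewrite inE => /orP[/eqP->|/IH].
  by rewrite leq_max leqnn.
by rewrite leq_max => ->; rewrite orbT.
Qed.

(** * Quantifier-free formulas under embeddings *)

Section Embedding.
Variables (L : signature) (M N : structure L) (h : M -> N) (emb : embedding h).

Lemma embedding_eval (s : nat -> M) (t : term L) :
  h (eval s t) = eval (fun n => h (s n)) t.
Proof.
case: emb => _ [hf _]; elim: t => [//|f a IH] /=.
by rewrite hf; congr ifun; apply: funext => i.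
Qed.

Lemma embedding_qf (p : formula L) (s : nat -> M) :
  qf p -> sat s p <-> sat (fun n => h (s n)) p.
Proof.
have [hi [_ hr]] := emb.
elim: p => //= [t u|r a|q IH|q IHq r IHr /andP[]|q IHq r IHr /andP[]|q IHq r IHr /andP[]].
- by rewrite -!embedding_eval => _; split=> [->|/hi].
- rewrite hr => _; under [X in _ <-> irel X]eq_fun do rewrite -embedding_eval.
  by [].
- by move=> /IH ->.
- by move=> /IHq -> /IHr ->.
- by move=> /IHq -> /IHr ->.
- by move=> /IHq IH1 /IHr IH2; tauto.
Qed.

End Embedding.

(** * Existence of existentially closed models *)

Section ExistentiallyClosed.
Variables (L : signature) (T : formula L -> Prop) (N0 : structure L) (x0 : N0).
Hypothesis N0T : models N0 T.
Variable code : formula L -> nat.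
Hypothesis code_inj : injective code.

(* The condition (p, l) asserts p of named elements, variable n denoting the
   element whose name is nth 0 l n. *)
Let cond : Type := (formula L * seq nat)%type.

Let csat (N : structure L) (s : nat -> N) (c : cond) : Prop :=
  sat (fun n => s (nth 0 c.2 n)) c.1.

(** Henkin witnesses: the leading existential quantifiers are stripped, and their variables receive
    the fresh names b, b + 1, and so on. The number returned is the next fresh name. *)
Fixpoint witness (p : formula L) (l : seq nat) (b : nat) : cond * nat :=
  match p with
  | Ex v q => witness q (set_nth 0 l v b) b.+1
  | _ => ((p, l), b)
  end.

(** Variables beyond the end of [l] denote the element named 0, so this forces b to be positive. *)
Let named (l : seq nat) (b : nat) := forall n, nth 0 l n < b.

Lemma named_set_nth l v b : named l b -> named (set_nth 0 l v b) b.+1.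
Proof. by move=> lb n; rewrite nth_set_nth /=; case: eqP => // _; apply/ltnW/lb. Qed.

Lemma witness_named p l b : named l b ->
  named (witness p l b).1.2 (witness p l b).2 /\ b <= (witness p l b).2.
Proof.
elim: p l b => //= v q IH l b lb.
have [? lt] := IH _ _ (named_set_nth v lb).
by split=> //; exact: ltnW.
Qed.

Lemma witness_qf p l b : existential p -> qf (witness p l b).1.1.
Proof. by elim: p l b => //= v q IH l b /IH. Qed.

Lemma update_set_nth (N : structure L) (s : nat -> N) l v b :
  update (fun n => s (nth 0 l n)) v (s b) = (fun n => s (nth 0 (set_nth 0 l v b) n)).
Proof. by apply: funext => n; rewrite /update nth_set_nth /=; case: eqP. Qed.

Lemma witness_sound (N : structure L) (s : nat -> N) p l b :
  csat s (witness p l b).1 -> csat s (p, l).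
Proof.
elim: p l b => //= v q IH l b /IH; rewrite /csat /= => H.
by exists (s b); rewrite update_set_nth.
Qed.

(** Only names from b on are reassigned, so that conditions on the older names stay true. *)
Lemma witness_exists (N : structure L) (s : nat -> N) p l b :
  named l b -> csat s (p, l) ->
  exists2 s' : nat -> N, (forall n, n < b -> s' n = s n) & csat s' (witness p l b).1.
Proof.
elim: p l b s => //=; try by intros; eexists; last eassumption.
move=> v q IH l b s lb; rewrite /csat /= => -[x Hx].
have [|s' s's Hs'] := IH (set_nth 0 l v b) b.+1 (update s b x) (named_set_nth v lb).
  rewrite /csat /=; have -> // : (fun n => update s b x (nth 0 (set_nth 0 l v b) n)) =
    update (fun n => s (nth 0 l n)) v x.
  apply: funext => n; rewrite /update nth_set_nth /=.
  case: (n =P v) => [|_]; first by rewrite eqxx.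
  by rewrite ltn_eqF.
exists s' => // n nb; rewrite s's ?ltnS 1?ltnW// /update.
by rewrite ltn_eqF.
Qed.

Let modelOf (C : set cond) (Ns : {N : structure L & nat -> N}) : Prop :=
  models (projT1 Ns) T /\ forall c, C c -> csat (projT2 Ns) c.

Let consistent (C : set cond) : Prop := exists Ns, modelOf C Ns.

Let ccode (c : cond) : nat := pickle (code c.1, c.2).

Lemma ccode_inj : injective ccode.
Proof.
by move=> [p l] [q m] /(pcan_inj pickleK) [/code_inj -> ->].
Qed.

Let bound (l : seq nat) : nat := (\max_(i <- l) i).+1.

Lemma named_bound l : named l (bound l).
Proof.
move=> n; rewrite /bound ltnS.
elim: l n => [|x l IH] [|n] //=; rewrite big_cons leq_max ?leqnn // IH orbT //.
Qed.

Lemma named_leq l b b' : b <= b' -> named l b -> named l b'.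
Proof. by move=> bb' lb n; apply: leq_trans bb'. Qed.

(** As codes are injective, stage k decides the only condition with code k: it is accepted if some
    model of [T] realizes it along with all earlier ones. *)
Let new (Cb : set cond * nat) (k : nat) (c : cond) : Prop :=
  [/\ ccode c = k, existential c.1 & consistent (Cb.1 `|` [set c])].

Let step (Cb : set cond * nat) (k : nat) : set cond * nat :=
  match pselect (exists c, new Cb k c) with
  | left e =>
    let c := sval (cid e) in
    let w := witness c.1 c.2 (maxn Cb.2 (bound c.2)) in
    (Cb.1 `|` [set w.1], w.2)
  | right _ => Cb
  end.

Fixpoint stage (k : nat) : set cond * nat :=
  if k is k'.+1 then step (stage k') k' else (set0, 0).

Lemma stage_named k c : (stage k).1 c -> named c.2 (stage k).2.
Proof.
elim: k c => //= k IH c; rewrite /step; case: pselect => [e|_]; last exact: IH.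
set d := sval _; have lb : named d.2 (maxn (stage k).2 (bound d.2)).
  by apply: named_leq (@named_bound _); exact: leq_maxr.
have [wn wb] := witness_named d.1 lb.
case=> [/IH|->//]; apply: named_leq; apply: leq_trans wb; exact: leq_maxl.
Qed.

Lemma stage_qf k c : (stage k).1 c -> qf c.1.
Proof.
elim: k c => //= k IH c; rewrite /step; case: pselect => [e|_]; last exact: IH.
case=> [/IH //|->]; case: (cid e) => d [_ de _] /=; exact: witness_qf.
Qed.

Lemma stage_consistent k : consistent (stage k).1.
Proof.
elim: k => /= [|k IH].
  by exists (existT (fun N : structure L => nat -> N) N0 (fun _ => x0)).
rewrite /step; case: pselect => [e|//]; case: (cid e) => c /= [_ _ [[N s] [/= NT sC]]].
set b := maxn _ _; have lb : named c.2 b.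
  by apply: named_leq (@named_bound _); exact: leq_maxr.
have /(witness_exists lb) : csat s (c.1, c.2) by have := sC c (or_intror erefl); case: (c).
move=> [s' s's Hs']; exists (existT (fun N : structure L => nat -> N) N s'); split=> //= d.
case=> [dC|->//]; have := sC d (or_introl dC); rewrite /csat.
suff -> : (fun n => s (nth 0 d.2 n)) = (fun n => s' (nth 0 d.2 n)) by [].
apply: funext => n; rewrite s's //; apply: leq_trans (leq_maxl _ _).
exact: stage_named dC _.
Qed.

Let G : set cond := [set c | exists k, (stage k).1 c].

Lemma stage_le k k' : k <= k' -> (stage k).1 `<=` (stage k').1.
Proof.
move=> /subnK <-; elim: (k' - k) => //= m IH c /IH.
by rewrite /step; case: pselect => // e ?; left.
Qed.

(** Genericity: a model of [T] that realizes all of [G] and an existential condition shows that this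
    condition was consistent at the stage of its code, where its witnessed form was therefore
    added. *)
Lemma generic_witness (N : structure L) (s : nat -> N) p l :
  models N T -> (forall c, G c -> csat s c) -> existential p -> csat s (p, l) ->
  exists2 b, named l b & G (witness p l b).1.
Proof.
move=> NT sG pe Hp; set k := ccode (p, l).
have e : exists c, new (stage k) k c.
  exists (p, l); split=> //; exists (existT (fun N : structure L => nat -> N) N s).
  by split=> //= c [ck|->//]; apply: sG; exists k.
exists (maxn (stage k).2 (bound l)).
  by apply: named_leq (@named_bound _); exact: leq_maxr.
exists k.+1 => /=; rewrite /step; case: pselect => [e'|//].
by right; have [/ccode_inj -> _ _] := svalP (cid e').
Qed.

Let U : set_system nat := sval (cid (ultraFilterLemma eventually_filter)).

Let UU : UltraFilter U.
Proof. by rewrite /U; case: cid => V [] /=. Qed.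

Lemma eventually_U A : \oo A -> U A.
Proof. by have [_] := svalP (cid (ultraFilterLemma eventually_filter)); apply. Qed.

(** The ultraproduct of models of the single stages plays the part of compactness: a condition of
    [G] holds in all stages from some point on, hence in [P] by Los's theorem. *)
Let Ns k := sval (cid (stage_consistent k)).
Let P := up U (fun k => projT1 (Ns k)).
Let gen (n : nat) : P := @cls L nat U (fun k => projT1 (Ns k)) (fun k => projT2 (Ns k) n).

Lemma generic_models : models P T.
Proof. by apply: (@up_models _ _ _ UU) => k; rewrite /Ns; case: cid => ? []. Qed.

Lemma generic_sat c : G c -> csat gen c.
Proof.
move=> [k ck]; rewrite /csat /gen.
apply/(@los _ _ _ UU _ c.1 (fun n k => projT2 (Ns k) (nth 0 c.2 n))).
apply: eventually_U; exists k => //= k' kk'.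
have [_ H] := svalP (cid (stage_consistent k')).
exact: H (stage_le kk' ck).
Qed.

Let Mcar : Type := {x : P | exists n, x = gen n}.

Lemma Mcar_choose (a : nat -> Mcar) : exists f : nat -> nat, forall n, sval (a n) = gen (f n).
Proof. by have [f fP] := choice (fun n => svalP (a n)); exists f. Qed.

Lemma Mcar_inj (x y : Mcar) : sval x = sval y -> x = y.
Proof. by case: x y => [x hx] [y hy] /= xy; apply: eq_exist. Qed.

(** The named elements form a substructure: that f has a value at named arguments is an existential
    condition true in [P], so genericity has named that value. *)
Lemma generic_ifun (f : Defs.fsym L) (a : 'I_(farity f) -> Mcar) :
  exists n, @ifun L P f (fun i => sval (a i)) = gen n.
Proof.
have [g gP] := choice (fun i => svalP (a i)).
pose l := [seq g i | i <- enum 'I_(farity f)].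
(* The arguments occupy the variables below [farity f], which is thus free to denote the value. *)
pose p := Ex (farity f) (Eq (@App L f (fun i => Var i)) (Var (farity f))).
have szl : size l = farity f by rewrite size_map size_enum_ord.
have El (i : 'I_(farity f)) : nth 0 l i = g i.
  by rewrite (nth_map i) ?size_enum_ord// nth_ord_enum.
have [||b lb [k kw]] := @generic_witness P gen p l generic_models generic_sat.
- by [].
- exists (@ifun L P f (fun i => sval (a i))) => /=.
  rewrite /update eqxx; congr (@ifun L P f); apply: funext => i.
  by rewrite ltn_eqF // El gP.
have /= := @generic_sat _ (ex_intro _ k kw).
rewrite /csat /= nth_set_nth /= eqxx => Eb; exists b; rewrite -Eb.
by congr (@ifun L P f); apply: funext => i; rewrite nth_set_nth /= ltn_eqF // El gP.
Qed.

Let M : structure L := @Structure L Mcar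
  (fun f a => exist _ _ (generic_ifun a))
  (fun r a => @irel L P r (fun i => sval (a i))).

Let genM (n : nat) : M := exist _ (gen n) (ex_intro _ n erefl).

Lemma generic_embedding : @embedding L M P (@sval _ _).
Proof. by split; [exact: Mcar_inj|split]. Qed.

Lemma genericM_sat c : G c -> csat genM c.
Proof.
move=> Gc; apply/(embedding_qf generic_embedding); first by case: Gc => k /stage_qf.
exact: generic_sat.
Qed.

(** The conditions in [G] are quantifier-free, so every extension of [M] realizes them. An
    existential formula true in an extension that is a model of [T] then has its witnessed form in
    [G], which also holds in [M]. *)
Lemma generic_ec (N : structure L) (h : M -> N) : embedding h -> models N T ->
  forall (p : formula L) (s : nat -> M), existential p ->
    sat (fun n => h (s n)) p -> sat s p.
Proof.
move=> emb NT p s pe Hp.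
have [f fP] := Mcar_choose s; pose l := mkseq f (fvbound p).
have sl n : n \in ffv p -> s n = genM (nth 0 l n).
  by move=> /mem_fvbound np; apply: Mcar_inj; rewrite nth_mkseq // fP.
apply/(sat_ext sl).
have [|||b lb /genericM_sat] := @generic_witness N (fun n => h (genM n)) p l NT.
- move=> c Gc; apply/(embedding_qf emb); first by case: Gc => k /stage_qf.
  exact: genericM_sat.
- exact: pe.
- by apply/sat_ext; last exact: Hp; move=> n /sl ->.
exact: witness_sound.
Qed.

(** The hypothesis lets [T] pass from a model to any structure existentially closed in it. It
    applies to the generic structure inside [P], and takes the place of inductivity of [T]. *)
Theorem ec_model_exists :
  (forall (P M : structure L) (h : M -> P), embedding h -> models P T ->
     (forall p s, existential p -> sat (fun n => h (s n)) p -> sat s p) ->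
     models M T) ->
  exists M : structure L, ec_model T M.
Proof.
move=> closedT; exists M; split; last exact: generic_ec.
apply: closedT generic_embedding generic_models _.
exact: generic_ec generic_embedding generic_models.
Qed.

End ExistentiallyClosed.

(** * Numbering of the formulas of a countable language *)

Section Coding.
Variables (L : signature) (cf : Defs.fsym L -> nat) (cr : rsym L -> nat).
Hypotheses (cf_inj : injective cf) (cr_inj : injective cr).

Fixpoint term_tree (t : term L) : GenTree.tree nat :=
  match t with
  | Var n => GenTree.Leaf n
  | App f a => GenTree.Node (cf f) [seq term_tree (a i) | i <- enum 'I_(farity f)]
  end.

Lemma term_tree_inj : injective term_tree.
Proof.
elim=> [n|f a IH] [m|g b] //= [].
  by move=> ->.
move=> /cf_inj fg; case: _ / fg b => b /eq_in_map E; congr App.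
by apply: funext => i; apply: IH; apply: E; rewrite mem_enum.
Qed.

Fixpoint formula_tree (p : formula L) : GenTree.tree nat :=
  match p with
  | Eq t u => GenTree.Node 0 [:: term_tree t; term_tree u]
  | Rel r a => GenTree.Node 1 (GenTree.Leaf (cr r) ::
                 [seq term_tree (a i) | i <- enum 'I_(rarity r)])
  | Fal => GenTree.Node 2 [::]
  | Neg q => GenTree.Node 3 [:: formula_tree q]
  | And q r => GenTree.Node 4 [:: formula_tree q; formula_tree r]
  | Or q r => GenTree.Node 5 [:: formula_tree q; formula_tree r]
  | Imp q r => GenTree.Node 6 [:: formula_tree q; formula_tree r]
  | Ex v q => GenTree.Node 7 [:: GenTree.Leaf v; formula_tree q]
  | All v q => GenTree.Node 8 [:: GenTree.Leaf v; formula_tree q]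
  end.

Lemma formula_tree_inj : injective formula_tree.
Proof.
elim=> [t u|r a||q IH|q IHq r IHr|q IHq r IHr|q IHq r IHr|v q IH|v q IH]
  [t' u'|r' a'||q'|q' r'|q' r'|q' r'|v' q'|v' q'] //= [].
- by move=> /term_tree_inj -> /term_tree_inj ->.
- move=> /cr_inj rr; case: _ / rr a' => a' /eq_in_map E; congr Rel.
  by apply: funext => i; apply: term_tree_inj; apply: E; rewrite mem_enum.
- by move=> /IH ->.
- by move=> /IHq -> /IHr ->.
- by move=> /IHq -> /IHr ->.
- by move=> /IHq -> /IHr ->.
- by move=> -> /IH ->.
- by move=> -> /IH ->.
Qed.

Definition formula_code (p : formula L) : nat := pickle (formula_tree p).

Lemma formula_code_inj : injective formula_code.
Proof. by move=> p q /(pcan_inj pickleK) /formula_tree_inj. Qed.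

Definition fsymMd_code (f : Defs.fsym (sigMd L)) : nat :=
  if f is Some g then (cf g).+1 else 0.

Lemma fsymMd_code_inj : injective fsymMd_code.
Proof. by move=> [f|] [g|] //= [] /cf_inj ->. Qed.

(** Formulas of [L] are themselves relation symbols of [sigMd L], so the coding is used twice: over
    [L] to number these symbols, then over [sigMd L]. *)
Definition rsymMd_code (r : rsym (sigMd L)) : nat :=
  match r with inl r0 => (cr r0).*2 | inr p => (formula_code p).*2.+1 end.

Lemma rsymMd_code_inj : injective rsymMd_code.
Proof.
move=> [r|p] [r'|p'] /=.
- by move=> /double_inj /cr_inj ->.
- by move=> /(congr1 odd) /=; rewrite !odd_double.
- by move=> /(congr1 odd) /=; rewrite !odd_double.
- by move=> [] /double_inj /formula_code_inj ->.
Qed.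

End Coding.

(** * Reducts, expansions and Morleyization *)

Section Reduct.
Variable L : signature.

Definition reduct (N : structure (sigMd L)) : structure L :=
  @Structure L N (fun f a => @ifun (sigMd L) N (Some f) a)
    (fun r a => @irel (sigMd L) N (inl r) a).

Definition delta (N : structure (sigMd L)) (x : N) : N :=
  @ifun (sigMd L) N None (fun _ => x).

Lemma eval_temb (N : structure (sigMd L)) (s : nat -> N) (t : term L) :
  eval s (temb t) = @eval L (reduct N) s t.
Proof.
elim: t => [//|f a IH] /=; congr (@ifun (sigMd L) N (Some f)).
exact: funext.
Qed.

Lemma sat_femb (N : structure (sigMd L)) (s : nat -> N) (p : formula L) :
  sat s (femb p) <-> @sat L (reduct N) s p.
Proof.
elim: p s => [t u|r a||q IH|q IHq r IHr|q IHq r IHr|q IHq r IHr|v q IH|v q IH] s.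
- by rewrite /= !eval_temb.
- rewrite /=; suff -> : (fun i => eval s (temb (a i))) =
    (fun i => @eval L (reduct N) s (a i)) by [].
  by apply: funext => i; exact: eval_temb.
- by [].
- by rewrite /= IH.
- by rewrite /= IHq IHr.
- by rewrite /= IHq IHr.
- by rewrite /= IHq IHr.
- by split=> -[x /IH Hx]; exists x.
- by split=> H x; apply/IH; exact: H.
Qed.

(* A Morley relation only sees the variables below [fvbound p]; the existential
   quantifier over assignments avoids choosing a default value for the others. *)
Definition expand (M : structure L) (d : M -> M) : structure (sigMd L) :=
  @Structure (sigMd L) M
    (fun f => match f return ('I_(@farity (sigMd L) f) -> M) -> M with
       | Some g => fun a => @ifun L M g a
       | None => fun a => d (a ord0)
       end)
    (fun r => match r return ('I_(@rarity (sigMd L) r) -> M) -> Prop with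
       | inl r0 => fun a => @irel L M r0 a
       | inr p => fun a => exists s : nat -> M, (forall i, s (nat_of_ord i) = a i) /\ sat s p
       end).

(** The reduct of the expansion is [M] up to eta for records; destructing [M] makes the two
    convertible. *)
Lemma sat_expand (M : structure L) (d : M -> M) (s : nat -> M) (p : formula L) :
  @sat (sigMd L) (expand d) s (femb p) <-> sat s p.
Proof. by rewrite sat_femb; case: M d s. Qed.

Lemma expand_rel (M : structure L) (d : M -> M) (p : formula L) (s : nat -> M) :
  @irel (sigMd L) (expand d) (inr p) (fun i => s (nat_of_ord i)) <-> sat s p.
Proof.
split=> [[s' [s's H]]|]; last by exists s.
apply/sat_ext; last exact: H.
by move=> n /mem_fvbound np; rewrite (s's (Ordinal np)).
Qed.

Section Morleyization.
Variables (add mul : Defs.fsym L) (T : formula L -> Prop).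

Lemma models_expand (M : structure L) (d : M -> M) : models M T ->
  @holds (sigMd L) (expand d) (ax_add add) -> @holds (sigMd L) (expand d) (ax_mul add mul) ->
  models (expand d) (TMd add mul T).
Proof.
move=> MT Hadd Hmul q [[p [Tp ->]]|[[p ->]|[->|->]]] //.
  by move=> s; apply/sat_expand; exact: MT.
move=> s; rewrite /morley_ax /=; change (s : nat -> expand d) with s.
have := expand_rel d p s; have := sat_expand d s p; rewrite /=; tauto.
Qed.

Lemma models_reduct (N : structure (sigMd L)) :
  models N (TMd add mul T) -> models (reduct N) T.
Proof. by move=> NT p Tp s; apply/sat_femb; apply: NT; left; exists p. Qed.

Lemma morley_rel (N : structure (sigMd L)) (s : nat -> N) (p : formula L) :
  models N (TMd add mul T) ->
  @irel (sigMd L) N (inr p) (fun i => s (nat_of_ord i)) <-> sat s (femb p).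
Proof.
move=> NT; have := NT (morley_ax p) (or_intror (or_introl (ex_intro _ p erefl))) s.
by rewrite /morley_ax /=; tauto.
Qed.

Lemma morley_relE (N : structure (sigMd L)) (x0 : N) (p : formula L) a :
  models N (TMd add mul T) ->
  @irel (sigMd L) N (inr p) a <->
  exists s : nat -> N, (forall i, s (nat_of_ord i) = a i) /\ @sat L (reduct N) s p.
Proof.
move=> NT; split=> [pa|[s [sa sp]]].
  pose s n := if insub n is Some i then a i else x0.
  have sa i : s (nat_of_ord i) = a i by rewrite /s valK.
  exists s; split=> //; apply/sat_femb/(morley_rel _ _ NT).
  by have -> : (fun i => s (nat_of_ord i)) = a by apply: funext.
have <- : (fun i => s (nat_of_ord i)) = a by apply: funext.
by apply/(morley_rel _ _ NT)/sat_femb.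
Qed.

(** Morley relations are atomic, so being existentially closed in [P] gives the Tarski-Vaught test
    for all formulas of [L]. The axioms for the derivation are universal and pass to
    substructures. *)
Lemma TMd_closed (P M : structure (sigMd L)) (h : M -> P) :
  embedding h -> models P (TMd add mul T) ->
  (forall p s, existential p -> sat (fun n => h (s n)) p -> sat s p) ->
  models M (TMd add mul T).
Proof.
move=> emb PT ecl.
have upd (s : nat -> M) v x : (fun n => h (update s v x n)) = update (fun n => h (s n)) v (h x).
  by apply: funext => n; rewrite /update; case: eqP.
have rel_qf (s : nat -> M) p : @irel (sigMd L) M (inr p) (fun i => s (nat_of_ord i)) <->
    sat (fun n => h (s n)) (femb p).
  by rewrite -(morley_rel _ _ PT); case: emb => _ [_ ->].
have E p s : sat (fun n => h (s n)) (femb p) <-> sat s (femb p).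
  elim: p s => [t u|r a||q IH|q IHq r IHr|q IHq r IHr|q IHq r IHr|v q IH|v q IH] s.
  - exact: iff_sym (embedding_qf emb s (isT : qf (femb (Eq t u)))).
  - exact: iff_sym (embedding_qf emb s (isT : qf (femb (Rel a)))).
  - by [].
  - by rewrite /= IH.
  - by rewrite /= IHq IHr.
  - by rewrite /= IHq IHr.
  - by rewrite /= IHq IHr.
  - split=> [[y Hy]|[x Hx]]; last by exists (h x); rewrite -upd; apply/IH.
    have [|x Hx] := ecl (Ex v (@Rel (sigMd L) (inr q) (fun i => Var i))) s isT.
      by exists y; apply/(morley_rel _ _ PT).
    by exists x; apply/IH/rel_qf.
  - split=> [Hy x|Hx y]; first by apply/IH; rewrite upd; exact: Hy.
    apply: contrapT => Hy.
    (* A counterexample to q is also described by an existential formula, the negation of an atomic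
       one. *)
    have [|x Hx'] := ecl (Ex v (Neg (@Rel (sigMd L) (inr q) (fun i => Var i)))) s isT.
      by exists y => /= /(morley_rel _ _ PT).
    by apply: Hx'; apply/rel_qf/IH; exact: Hx.
move=> q [[p [Tp ->]]|[[p ->]|H]] s.
- by apply/E; apply: PT; left; exists p.
- by have := rel_qf s p; have := E p s; rewrite /morley_ax /=; tauto.
- apply/(embedding_qf emb); first by case: H => ->.
  by apply: PT; right; right.
Qed.

End Morleyization.
End Reduct.

(** * Extension of derivations *)

Section DualNumbers.
Import GRing.Theory.
Local Open Scope ring_scope.

(** The pair (a, b) is a + b e in F[e] / (e^2). A map d is a derivation exactly when x -> (x, d x)
    is additive and multiplicative. *)
Definition dual (F : comNzRingType) : Type := (F * F)%type.

HB.instance Definition _ (F : comNzRingType) := GRing.Zmodule.copy (dual F) (F * F)%type.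

Section DualRing.
Variable F : comNzRingType.

Definition dual_mul (a b : dual F) : dual F := (a.1 * b.1, a.1 * b.2 + b.1 * a.2).
Definition dual_one : dual F := (1, 0).

Lemma dual_mulA : associative dual_mul.
Proof.
by move=> a b c; congr pair => /=; ring.
Qed.

Lemma dual_mulC : commutative dual_mul.
Proof. by move=> a b; rewrite /dual_mul mulrC addrC. Qed.

Lemma dual_mul1 : left_id dual_one dual_mul.
Proof. by move=> [a b]; rewrite /dual_mul /= mulr0 addr0 !mul1r. Qed.

Lemma dual_mulDl : left_distributive dual_mul +%R.
Proof.
move=> a b c; rewrite /dual_mul /=; congr pair; first by rewrite mulrDl.
by rewrite mulrDl mulrDr addrACA.
Qed.

Lemma dual_oner_neq0 : dual_one != 0.
Proof. by apply/eqP => -[/eqP]; rewrite oner_eq0. Qed.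

HB.instance Definition _ := GRing.Zmodule_isComNzRing.Build (dual F)
  dual_mulA dual_mulC dual_mul1 dual_mulDl dual_oner_neq0.

Lemma dual_mul1E (a b : dual F) : (a * b).1 = a.1 * b.1. Proof. by []. Qed.
Lemma dual_mul2E (a b : dual F) : (a * b).2 = a.1 * b.2 + b.1 * a.2. Proof. by []. Qed.

Lemma dual_exp1E (a : dual F) n : (a ^+ n).1 = a.1 ^+ n.
Proof. by elim: n => // n IH; rewrite !exprS dual_mul1E IH. Qed.

Lemma dual_sum1E (I : Type) (r : seq I) (P : pred I) (f : I -> dual F) :
  (\sum_(i <- r | P i) f i).1 = \sum_(i <- r | P i) (f i).1.
Proof. by elim/big_rec2: _ => // i x y _ <-. Qed.

Lemma dual_natmul1E (a : dual F) n : (a *+ n).1 = a.1 *+ n.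
Proof. by elim: n => // n IH; rewrite !mulrS -IH. Qed.

Lemma horner_dual1 (p : {poly dual F}) (c : dual F) n : (size p <= n)%nat ->
  p.[c].1 = \sum_(i < n) (p`_i).1 * c.1 ^+ i.
Proof.
move=> /horner_coef_wide ->; rewrite dual_sum1E.
by apply: eq_bigr => i _; rewrite dual_mul1E dual_exp1E.
Qed.

(** Taylor expansion at z, cut after the linear term because e^2 = 0. *)
Lemma horner_dual_taylor (p : {poly dual F}) (z w : F) :
  p.[(z, w) : dual F] = p.[(z, 0) : dual F] + (0, p^`().[(z, 0) : dual F].1 * w).
Proof.
elim/poly_ind: p => [|p c IH]; first by rewrite deriv0 !horner0 /= mul0r add0r.
rewrite derivMXaddC !hornerE IH.
by rewrite [RHS]surjective_pairing [LHS]surjective_pairing /=; congr pair; ring.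
Qed.

End DualRing.

Section Graph.
Variable F : fieldType.
Implicit Types (D : set (dual F)) (p q : {poly dual F}) (c : dual F).

(* A derivation on a subring is encoded by its graph, a subring of the dual numbers in which the
   first component determines the second. *)
Record derivation_graph D : Prop := DerivationGraph {
  graph1 : D 1;
  graphB : forall a b, D a -> D b -> D (a - b);
  graphM : forall a b, D a -> D b -> D (a * b);
  graph_eq0 : forall a, D a -> a.1 = 0 -> a = 0 }.

Definition coefs_in D p := forall i, D p`_i.

Definition adjoin D c : set (dual F) := [set p.[c] | p in coefs_in D].

Section Subring.
Variables (D : set (dual F)) (Dg : derivation_graph D).

Lemma graph0 : D 0.
Proof. by rewrite -(subrr 1); apply: graphB => //; exact: graph1. Qed.

Lemma graphD a b : D a -> D b -> D (a + b).
Proof.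
move=> Da Db; rewrite -[b]opprK -[- b]sub0r.
by apply: graphB => //; apply: graphB => //; exact: graph0.
Qed.

Lemma graphMn a n : D a -> D (a *+ n).
Proof. by move=> Da; elim: n => [|n IH]; rewrite ?mulrS; [exact: graph0|exact: graphD]. Qed.

Lemma coefs_inC a : D a -> coefs_in D a%:P.
Proof. by move=> Da i; rewrite coefC; case: eqP => // _; exact: graph0. Qed.

Lemma coefs_inX : coefs_in D 'X.
Proof. by move=> i; rewrite coefX; case: eqP => _; [exact: graph1|exact: graph0]. Qed.

Lemma coefs_inB p q : coefs_in D p -> coefs_in D q -> coefs_in D (p - q).
Proof. by move=> Dp Dq i; rewrite coefB; exact: graphB. Qed.

Lemma coefs_inM p q : coefs_in D p -> coefs_in D q -> coefs_in D (p * q).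
Proof.
move=> Dp Dq i; rewrite coefM; apply: (big_ind D) => [||j _]; first exact: graph0.
- by move=> a b; exact: graphD.
- by apply: (graphM Dg); [exact: Dp|exact: Dq].
Qed.

Lemma coefs_inXn n : coefs_in D 'X^n.
Proof. by move=> i; rewrite coefXn; case: eqP => _; [exact: graph1|exact: graph0]. Qed.

Lemma coefs_in_deriv p : coefs_in D p -> coefs_in D p^`().
Proof. by move=> Dp i; rewrite coef_deriv; exact: graphMn. Qed.

Lemma sub_adjoin c : D `<=` adjoin D c.
Proof. by move=> a Da; exists a%:P; [exact: coefs_inC|rewrite hornerC]. Qed.

Lemma mem_adjoin c : adjoin D c c.
Proof. by exists 'X; [exact: coefs_inX|rewrite hornerX]. Qed.

Lemma adjoin_graph c : (forall p, coefs_in D p -> p.[c].1 = 0 -> p.[c] = 0) ->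
  derivation_graph (adjoin D c).
Proof.
move=> H; split.
- by apply: sub_adjoin; exact: graph1 Dg.
- move=> _ _ [p Dp <-] [q Dq <-]; exists (p - q); first exact: coefs_inB.
  by rewrite hornerD hornerN.
- move=> _ _ [p Dp <-] [q Dq <-]; exists (p * q); first exact: coefs_inM.
  by rewrite hornerM.
- by move=> _ [p Dp <-]; exact: H.
Qed.

Lemma horner_dual_fst p (z w w' : F) : p.[(z, w) : dual F].1 = p.[(z, w') : dual F].1.
Proof. by rewrite !(@horner_dual1 _ p _ _ (leqnn _)). Qed.

(** When z satisfies no equation over the domain of [D], there is nothing to respect and the value w
    is arbitrary. *)
Lemma adjoin_transcendental (z w : F) :
  (forall p, coefs_in D p -> p.[(z, 0) : dual F].1 = 0 -> p = 0) ->
  derivation_graph (adjoin D (z, w)).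
Proof.
move=> H; apply: adjoin_graph => p Dp; rewrite (horner_dual_fst p z w 0) => /(H _ Dp) ->.
by rewrite horner0.
Qed.

Hypothesis char0 : forall n, n.+1%:R != 0 :> F.

(** The root at z excludes constants; the top coefficient is then multiplied by a positive integer,
    which is nonzero in characteristic 0. *)
Lemma graph_poly_deriv_neq0 p (z : F) : coefs_in D p -> p != 0 ->
  p.[(z, 0) : dual F].1 = 0 -> p^`() != 0.
Proof.
move=> Dp p0 pz; have sp : (1 < size p)%nat.
  rewrite ltnNge; apply: contra_neqN p0 => /size1_polyC pc.
  move: pz (Dp 0); rewrite pc hornerC coefC /= => c1 Dc.
  by rewrite (graph_eq0 Dg Dc c1).
apply/eqP => /polyP /(_ (size p).-2); rewrite coef_deriv coef0.
case: (size p) sp (lead_coefE p) => [|[|n]] //= _ lp /(congr1 fst).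
rewrite dual_natmul1E /= -mulr_natr => /eqP.
rewrite mulf_eq0 (negbTE (char0 n)) orbF -lp => /eqP.
by move=> /(graph_eq0 Dg (Dp _)) /eqP; rewrite -[_ == _]/(lead_coef p == 0) lead_coef_eq0 (negbTE p0).
Qed.

(* Pseudo-division, since the domain of D need not be closed under inverses. *)
Lemma graph_poly_reduce p q : coefs_in D p -> coefs_in D q -> p != 0 ->
  (size p <= size q)%nat ->
  exists2 r, coefs_in D r /\ (size r < size q)%nat &
  exists s, r = (lead_coef p)%:P * q - s * p.
Proof.
move=> Dp Dq p0 pq; set k := (size q - size p)%nat.
exists ((lead_coef p)%:P * q - (lead_coef q)%:P * 'X^k * p); last by eexists.
split.
  apply: coefs_inB; first by apply: coefs_inM => //; apply: coefs_inC; exact: Dp.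
  by apply: coefs_inM => //; apply: coefs_inM; [apply: coefs_inC; exact: Dq|exact: coefs_inXn].
have sp : (0 < size p)%nat by rewrite size_poly_gt0.
have sq : (0 < size q)%nat by exact: leq_trans pq.
rewrite -(prednK sq) ltnS; apply/leq_sizeP => j qj.
rewrite coefB coefCM -mulrA coefCM coefXnM.
have -> : (j < k)%nat = false.
  by apply/negbTE; rewrite -leqNgt (leq_trans _ qj)// /k -ltnS prednK // ltn_subrL sp sq.
move: qj; rewrite leq_eqVlt => /orP[/eqP<-|qj].
  have -> : ((size q).-1 - k = (size p).-1)%nat.
    rewrite /k; move: pq sp sq; clear; move: (size p) (size q) => m n; lia.
  by rewrite -!lead_coefE mulrC subrr.
have qj' : (size q <= j)%nat by rewrite -(prednK sq).
rewrite (nth_default _ qj') nth_default ?mulr0 ?subrr //.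
by rewrite leq_subRL ?(leq_trans (leq_subr _ _) qj')// /k subnK.
Qed.

(** In the algebraic case, an annihilating p of least size has a derivative that does not vanish at
    z. The equation p = 0 at (z, w) then determines w, and pseudo-division by p shows that w
    respects all other equations of z. *)
Lemma graph_adjoin (z : F) : exists w, derivation_graph (adjoin D (z, w)).
Proof.
pose alg p := [/\ coefs_in D p, p != 0 & p.[(z, 0) : dual F].1 = 0].
case: (pselect (exists p, alg p)) => [|noalg]; last first.
  exists 0; apply: adjoin_transcendental => p Dp pz.
  by apply/eqP; apply: contrapT => /negP p0; apply: noalg; exists p.
move=> [p0 algp0].
have [p [Dp pn0 pz] pmin] : exists2 p, alg p & forall q, alg q -> (size p <= size q)%nat.
  have ex : exists n, `[< exists2 q, alg q & size q = n >].
    by exists (size p0); apply/asboolP; exists p0.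
  case: (ex_minnP ex) => n /asboolP[q algq <-] qmin; exists q => // r algr.
  by apply: qmin; apply/asboolP; exists r.
have low q : coefs_in D q -> q.[(z, 0) : dual F].1 = 0 -> (size q < size p)%nat -> q = 0.
  move=> Dq qz qp; apply/eqP; apply: contrapT => /negP q0.
  by have := pmin q; rewrite leqNgt qp => /(_ (And3 Dq q0 qz)).
have p'z : p^`().[(z, 0) : dual F].1 != 0.
  apply: contra_neq (graph_poly_deriv_neq0 Dp pn0 pz) => p'z.
  by apply: low => //; [exact: coefs_in_deriv|exact: lt_size_deriv].
(* The solution of the linear equation that the Taylor expansion gives for the second component of
   p. *)
pose w := - p.[(z, 0) : dual F].2 / p^`().[(z, 0) : dual F].1.
have pw : p.[(z, w) : dual F] = 0.
  rewrite horner_dual_taylor [_.[_]]surjective_pairing pz /w.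
  by congr pair => /=; rewrite ?addr0 // mulrCA divff // mulr1 subrr.
exists w; apply: adjoin_graph => q.
have [n] := ubnP (size q); elim: n q => // n IH q; rewrite ltnS => qn Dq qz.
case: (ltnP (size q) (size p)) => qp.
  by rewrite (low q) ?horner0 // (horner_dual_fst q z 0 w).
have [r [Dr rq] [s rE]] := graph_poly_reduce Dp Dq pn0 qp.
have rw : r.[(z, w) : dual F] = lead_coef p * q.[(z, w) : dual F].
  by rewrite rE !hornerE pw mulr0 subr0.
have r0 : r.[(z, w) : dual F] = 0.
  by apply: IH => //; [exact: leq_trans rq qn|rewrite rw dual_mul1E qz mulr0].
(* The leading coefficient of p has nonzero first component, since its vanishing would make the
   whole coefficient zero; it can be cancelled. *)
move: rw; rewrite r0 => /(congr1 snd); rewrite dual_mul2E qz mul0r addr0 => /esym/eqP.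
rewrite mulf_eq0 => /orP[/eqP lp0|/eqP q2]; last by rewrite [LHS]surjective_pairing qz q2.
by have := graph_eq0 Dg (Dp _) lp0; move/eqP; rewrite -[_ == _]/(lead_coef p == 0) lead_coef_eq0 (negbTE pn0).
Qed.

End Subring.

Hypothesis char0 : forall n, n.+1%:R != 0 :> F.

Theorem graph_extension D : derivation_graph D ->
  exists d : F -> F, [/\ forall x y, d (x + y) = d x + d y,
    forall x y, d (x * y) = x * d y + y * d x &
    forall a, D a -> d a.1 = a.2].
Proof.
(* The union with [D] makes the empty chain harmless in Zorn's lemma. *)
move=> Dg; pose Q A := derivation_graph (D `|` A).
have [|A [QA Amax]] := @Zorn_bigcup _ Q.
  move=> C CQ Ctot.
  have [C0|[X0 CX0]] : (forall X, ~ C X) \/ exists X, C X.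
    by case: (pselect (exists X, C X)); [right|move/forallNP; left].
    suff -> : \bigcup_(X in C) X = set0 by rewrite /Q setU0.
    by apply/seteqP; split=> // x [X /C0].
  have two a b : (D `|` \bigcup_(X in C) X) a -> (D `|` \bigcup_(X in C) X) b ->
      exists2 X, C X & (D `|` X) a /\ (D `|` X) b.
    move=> [Da|[X CX Xa]] [Db|[Y CY Yb]].
    - by exists X0 => //; split; left.
    - by exists Y => //; split; [left|right].
    - by exists X => //; split; [right|left].
    - have [XY|YX] := Ctot _ _ CX CY.
      + by exists Y => //; split; right => //; exact: XY.
      + by exists X => //; split; right => //; exact: YX.
  have incl X : C X -> (D `|` X) `<=` (D `|` \bigcup_(X in C) X).
    by move=> CX x [|Xx]; [left|right; exists X].
  split.
  - by left; exact: graph1.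
  - by move=> a b /two H /H[X CX [Xa Xb]]; apply: (incl X CX); have Qx : derivation_graph (D `|` X) := CQ _ CX; exact: (graphB Qx).
  - by move=> a b /two H /H[X CX [Xa Xb]]; apply: (incl X CX); have Qx : derivation_graph (D `|` X) := CQ _ CX; exact: (graphM Qx).
  - by move=> a Xa; have [X CX [Xa' _]] := two a a Xa Xa; have Qx : derivation_graph (D `|` X) := CQ _ CX; exact: (graph_eq0 Qx) Xa'.
have {}QA : derivation_graph (D `|` A) := QA.
(* A point without a value could be adjoined, against maximality. *)
have total z : exists w, (D `|` A) (z, w).
  have [w] := graph_adjoin QA char0 z; set B := adjoin _ _ => Bg; exists w.
  have DB : D `|` A `<=` B := @sub_adjoin _ QA _.
  have Bzw : B (z, w) := @mem_adjoin _ QA _.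
  apply: contrapT => nzw; apply: (Amax B).
    split; first by move=> x Ax; apply: DB; right.
    by move=> BA; apply: nzw; right; exact: BA.
  by rewrite /Q setUidr // => x Dx; apply: DB; left.
have uniq z w w' : (D `|` A) (z, w) -> (D `|` A) (z, w') -> w = w'.
  move=> H H'; have /(graph_eq0 QA)/= := graphB QA H H'.
  by rewrite subrr => /(_ erefl) /(congr1 snd) /= /eqP; rewrite subr_eq0 => /eqP.
have [d dP] := choice total.
exists d; split.
- by move=> x y; apply: uniq (dP _) _; exact: graphD QA _ _ (dP x) (dP y).
- by move=> x y; apply: uniq (dP _) _; have := graphM QA (dP x) (dP y); exact.
- by move=> [x y] Dxy; apply: uniq (dP _) _; left.
Qed.

(** Algebraic independence over the first projection of [D]; the one bound n serves both degrees. *)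
Definition independent_over D (x y : F) := forall n (a : nat -> nat -> dual F),
  (forall i j, D (a i j)) ->
  \sum_(i < n) (\sum_(j < n) (a i j).1 * x ^+ j) * y ^+ i = 0 ->
  forall i j, (i < n)%nat -> (j < n)%nat -> a i j = 0.

(** Adjoin x, then y: each is transcendental over what precedes it, so both values are free. The
    result extends to all of [F]. *)
Theorem graph_extension_independent D (x y u v : F) :
  derivation_graph D -> independent_over D x y ->
  exists d : F -> F, [/\ forall x y, d (x + y) = d x + d y,
    forall x y, d (x * y) = x * d y + y * d x,
    forall a, D a -> d a.1 = a.2, d x = u & d y = v].
Proof.
move=> Dg indep.
have D1g : derivation_graph (adjoin D (x, u)).
  apply: adjoin_transcendental => // p Dp px.
  apply/polyP => j; rewrite coef0; case: (ltnP j (size p)) => [jp|]; last first.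
    by move=> ?; rewrite nth_default.
  pose a i j := if i is 0%nat then p`_j else 0.
  have := indep (size p) a _ _ 0%nat j; apply => //.
  - by move=> [|i] k; [exact: Dp|exact: graph0].
  - case: (size p) (@horner_dual1 _ p (x, 0) _ (leqnn (size p))) => [|n] E.
      by rewrite big_ord0.
    rewrite big_ord_recl expr0 mulr1 -E px add0r big1 // => i _.
    by rewrite big1 ?mul0r // => k _; rewrite mul0r.
  - exact: leq_ltn_trans jp.
have D2g : derivation_graph (adjoin (adjoin D (x, u)) (y, v)).
  apply: adjoin_transcendental => // p Dp py.
  (* The coefficients of p are values of polynomials at x, so p becomes a polynomial in two
     variables over [D]. *)
  have [q qP] : exists q : nat -> {poly dual F}, forall i,
      coefs_in D (q i) /\ p`_i = (q i).[(x, u) : dual F].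
    have /choice [q qP] : forall i, exists q, coefs_in D q /\ p`_i = q.[(x, u) : dual F].
      by move=> i; have [q Dq <-] := Dp i; exists q.
    by exists q.
  pose n := maxn (size p) (\max_(i < size p) size (q i)).
  have pn : (size p <= n)%nat by exact: leq_maxl.
  have qn i : (i < size p)%nat -> (size (q i) <= n)%nat.
    move=> ip; apply: leq_trans (leq_maxr _ _).
    exact: (@leq_bigmax _ (fun i : 'I_(size p) => size (q i)) (Ordinal ip)).
  pose a i j := if (i < size p)%nat then (q i)`_j else 0.
  apply/polyP => i; rewrite coef0; case: (ltnP i (size p)) => [ip|]; last first.
    by move=> ?; rewrite nth_default.
  rewrite (qP i).2; suff -> : q i = 0 by rewrite horner0.
  apply/polyP => j; rewrite coef0; case: (ltnP j (size (q i))) => [jq|]; last first.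
    by move=> ?; rewrite nth_default.
  have <- : a i j = (q i)`_j by rewrite /a ip.
  apply: (indep n).
  - by move=> i' j'; rewrite /a; case: ifP => // _; [exact: (qP i').1|exact: graph0].
  - rewrite -[RHS]py (horner_dual1 _ pn); apply: eq_bigr => k _; congr (_ * _).
    rewrite /a; case: (ltnP k (size p)) => [kp|pk].
      by rewrite (qP k).2 (horner_dual1 _ (qn _ kp)).
    by rewrite nth_default // big1 // => l _; rewrite mul0r.
  - exact: leq_trans ip pn.
  - exact: leq_trans jq (qn _ ip).
have [d [dD dM dE]] := graph_extension D2g.
exists d; split=> //.
- by move=> a Da; apply: dE; apply: sub_adjoin => //; exact: sub_adjoin.
- by apply: (dE (x, u)); apply: sub_adjoin => //; exact: mem_adjoin.
- by apply: (dE (y, v)); exact: mem_adjoin.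
Qed.

End Graph.
End DualNumbers.

(** * Models of the theory of the reals with restricted exponential *)

Definition pair2 (T : Type) (x y : T) (i : 'I_2) : T := if nat_of_ord i == 0 then x else y.

Definition no_args (T : Type) (i : 'I_0) : T :=
  match notF (ltn_ord i) with end.

Definition tzero : term Lexp := @App Lexp Fzero (@no_args _).
Definition tone : term Lexp := @App Lexp Fone (@no_args _).
Definition tadd (t u : term Lexp) : term Lexp := @App Lexp Fadd (pair2 t u).
Definition tmul (t u : term Lexp) : term Lexp := @App Lexp Fmul (pair2 t u).
Definition topp (t : term Lexp) : term Lexp := @App Lexp Fneg (fun _ => t).
Definition texp (t : term Lexp) : term Lexp := @App Lexp Fexp (fun _ => t).

Section SatEquations.
Variables (L : signature) (M : structure L) (s : nat -> M).

Lemma eval_Var n : eval s (Var n) = s n. Proof. by []. Qed.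
Lemma sat_Eq (t u : term L) : sat s (Eq t u) = (eval s t = eval s u). Proof. by []. Qed.
Lemma sat_Neg (p : formula L) : sat s (Neg p) = ~ sat s p. Proof. by []. Qed.
Lemma sat_And (p q : formula L) : sat s (And p q) = (sat s p /\ sat s q). Proof. by []. Qed.
Lemma sat_Or (p q : formula L) : sat s (Or p q) = (sat s p \/ sat s q). Proof. by []. Qed.
Lemma sat_Imp (p q : formula L) : sat s (Imp p q) = (sat s p -> sat s q). Proof. by []. Qed.
Lemma sat_Ex v (p : formula L) : sat s (Ex v p) = exists x, sat (update s v x) p.
Proof. by []. Qed.

Definition satE := (sat_Eq, sat_Neg, sat_And, sat_Or, sat_Imp, sat_Ex).

End SatEquations.

Record exp_model := ExpModel {
  exp_struct :> structure Lexp;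
  exp_modelP : models exp_struct (Th Rexp_struct) }.

Definition real_exp_model : exp_model := @ExpModel Rexp_struct (fun p Tp => Tp).

(** A head symbol of its own, to which the field structure of every model is attached. *)
Definition expcar (M : exp_model) : Type := carrier M.

HB.instance Definition _ (M : exp_model) := gen_eqMixin (expcar M).
HB.instance Definition _ (M : exp_model) := gen_choiceMixin (expcar M).

Section ExpField.
Variable M : exp_model.

Definition expcar0 : expcar M := @ifun Lexp M Fzero (@no_args _).
Definition expcar1 : expcar M := @ifun Lexp M Fone (@no_args _).
Definition expcar_add (x y : expcar M) : expcar M := @ifun Lexp M Fadd (pair2 x y).
Definition expcar_mul (x y : expcar M) : expcar M := @ifun Lexp M Fmul (pair2 x y).
Definition expcar_opp (x : expcar M) : expcar M := @ifun Lexp M Fneg (fun _ => x).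
Definition rexp (x : expcar M) : expcar M := @ifun Lexp M Fexp (fun _ => x).

Implicit Types (s : nat -> expcar M) (t u : term Lexp).

Lemma eval_tzero s : @eval Lexp M s tzero = expcar0.
Proof. by congr (@ifun Lexp M Fzero); apply: funext => -[]. Qed.

Lemma eval_tone s : @eval Lexp M s tone = expcar1.
Proof. by congr (@ifun Lexp M Fone); apply: funext => -[]. Qed.

Lemma eval_tadd s t u : @eval Lexp M s (tadd t u) = expcar_add (eval s t) (eval s u).
Proof. by congr (@ifun Lexp M Fadd); apply: funext => i; rewrite /pair2; case: ifP. Qed.

Lemma eval_tmul s t u : @eval Lexp M s (tmul t u) = expcar_mul (eval s t) (eval s u).
Proof. by congr (@ifun Lexp M Fmul); apply: funext => i; rewrite /pair2; case: ifP. Qed.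

Lemma eval_topp s t : @eval Lexp M s (topp t) = expcar_opp (eval s t).
Proof. by []. Qed.

Lemma eval_texp s t : @eval Lexp M s (texp t) = rexp (eval s t).
Proof. by []. Qed.

Definition eval_ring := (eval_tzero, eval_tone, eval_tadd, eval_tmul, eval_topp, eval_texp, eval_Var).

Lemma transfer (p : formula Lexp) : holds Rexp_struct p -> @holds Lexp M p.
Proof. exact: exp_modelP. Qed.

Let val3 (x y z : expcar M) (n : nat) : expcar M :=
  match n with 0 => x | 1 => y | _ => z end.

Lemma expcar_addA : associative expcar_add.
Proof.
move=> x y z.
have := @transfer (Eq (tadd (Var 0) (tadd (Var 1) (Var 2))) (tadd (tadd (Var 0) (Var 1)) (Var 2)))
  (fun _ => esym (Rplus_assoc _ _ _)) (val3 x y z).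
by rewrite !satE !eval_ring.
Qed.

Lemma expcar_addC : commutative expcar_add.
Proof.
move=> x y; have := @transfer (Eq (tadd (Var 0) (Var 1)) (tadd (Var 1) (Var 0)))
  (fun _ => Rplus_comm _ _) (val3 x y x).
by rewrite !satE !eval_ring.
Qed.

Lemma expcar_add0 : left_id expcar0 expcar_add.
Proof.
move=> x; have := @transfer (Eq (tadd tzero (Var 0)) (Var 0))
  (fun _ => Rplus_0_l _) (val3 x x x).
by rewrite !satE !eval_ring.
Qed.

Lemma expcar_addN : left_inverse expcar0 expcar_opp expcar_add.
Proof.
move=> x; have := @transfer (Eq (tadd (topp (Var 0)) (Var 0)) tzero)
  (fun _ => Rplus_opp_l _) (val3 x x x).
by rewrite !satE !eval_ring.
Qed.

Lemma expcar_mulA : associative expcar_mul.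
Proof.
move=> x y z.
have := @transfer (Eq (tmul (Var 0) (tmul (Var 1) (Var 2))) (tmul (tmul (Var 0) (Var 1)) (Var 2)))
  (fun _ => esym (Rmult_assoc _ _ _)) (val3 x y z).
by rewrite !satE !eval_ring.
Qed.

Lemma expcar_mulC : commutative expcar_mul.
Proof.
move=> x y; have := @transfer (Eq (tmul (Var 0) (Var 1)) (tmul (Var 1) (Var 0)))
  (fun _ => Rmult_comm _ _) (val3 x y x).
by rewrite !satE !eval_ring.
Qed.

Lemma expcar_mul1 : left_id expcar1 expcar_mul.
Proof.
move=> x; have := @transfer (Eq (tmul tone (Var 0)) (Var 0))
  (fun _ => Rmult_1_l _) (val3 x x x).
by rewrite !satE !eval_ring.
Qed.

Lemma expcar_mulDl : left_distributive expcar_mul expcar_add.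
Proof.
move=> x y z.
have := @transfer (Eq (tmul (tadd (Var 0) (Var 1)) (Var 2))
    (tadd (tmul (Var 0) (Var 2)) (tmul (Var 1) (Var 2))))
  (fun _ => Rmult_plus_distr_r _ _ _) (val3 x y z).
by rewrite !satE !eval_ring.
Qed.

Lemma expcar_one_neq0 : expcar1 != expcar0.
Proof.
apply/eqP; have := @transfer (Neg (Eq tone tzero)) (fun _ => R1_neq_R0) (fun _ => expcar0).
by rewrite !satE !eval_ring.
Qed.

Lemma expcar_inv_exists (x : expcar M) : exists y, x != expcar0 -> expcar_mul y x = expcar1.
Proof.
have [->|/eqP x0] := eqVneq x expcar0; first by exists expcar0.
have := @transfer (Imp (Neg (Eq (Var 0) tzero)) (Ex 1 (Eq (tmul (Var 1) (Var 0)) tone)))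
  ltac:(move=> s /= s0; exists (Rinv (s 0)); exact: Rinv_l) (val3 x x x).
rewrite !satE !eval_ring => /(_ x0) [y]; rewrite !satE !eval_ring => yx.
by exists y.
Qed.

Definition expcar_inv (x : expcar M) : expcar M :=
  if x == expcar0 then expcar0 else sval (cid (expcar_inv_exists x)).

Lemma expcar_mulVx (x : expcar M) : x != expcar0 -> expcar_mul (expcar_inv x) x = expcar1.
Proof. by move=> x0; rewrite /expcar_inv ifN //; exact: svalP (cid (expcar_inv_exists x)) x0. Qed.

Lemma expcar_inv0 : expcar_inv expcar0 = expcar0.
Proof. by rewrite /expcar_inv ifT. Qed.

HB.instance Definition _ := GRing.isZmodule.Build (expcar M) expcar_addA expcar_addC expcar_add0 expcar_addN.
HB.instance Definition _ := GRing.Zmodule_isComNzRing.Build (expcar M)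
  expcar_mulA expcar_mulC expcar_mul1 expcar_mulDl expcar_one_neq0.
HB.instance Definition _ := GRing.ComNzRing_isField.Build (expcar M) expcar_mulVx expcar_inv0.

End ExpField.

(** * Polynomial relations between exponentials in the reals *)

Section Terms.
Import GRing.Theory.
Local Open Scope ring_scope.

Definition tnat n : term Lexp := iter n (tadd tone) tzero.
Definition tpow (t : term Lexp) n : term Lexp := iter n (tmul t) tone.
Definition tsum n (f : nat -> term Lexp) : term Lexp :=
  foldr (fun i t => tadd (f i) t) tzero (iota 0 n).

(* The polynomial sum_(i, j < d) a i j * X ^ j * Y ^ i at X = exp (c t), Y = exp t,
   where c is variable 0, t is variable 1 and the a i j are the next d ^ 2 variables. *)
Definition tpoly2 d : term Lexp :=
  tsum d (fun i => tmul
    (tsum d (fun j => tmul (Var (i * d + j).+2) (tpow (texp (tmul (Var 0) (Var 1))) j)))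
    (tpow (texp (Var 1)) i)).

Section Eval.
Variable M : exp_model.
Implicit Types s : nat -> expcar M.

Lemma eval_ringE s :
  (@eval Lexp M s tzero = 0 :> expcar M) * (@eval Lexp M s tone = 1 :> expcar M) *
  (forall t u, @eval Lexp M s (tadd t u) = (eval s t : expcar M) + eval s u) *
  (forall t u, @eval Lexp M s (tmul t u) = (eval s t : expcar M) * eval s u) *
  (forall t, @eval Lexp M s (texp t) = rexp (eval s t)) *
  (forall n, @eval Lexp M s (Var n) = s n).
Proof. by do !split=> *; rewrite ?eval_ring. Qed.

Lemma eval_tnat s n : @eval Lexp M s (tnat n) = n%:R :> expcar M.
Proof.
elim: n => [|n IH]; first by rewrite eval_ringE.
by rewrite -[tnat _]/(tadd tone (tnat n)) !eval_ringE mulrS -IH.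
Qed.

Lemma eval_tpow s t n : @eval Lexp M s (tpow t n) = (eval s t : expcar M) ^+ n :> expcar M.
Proof.
elim: n => [|n IH]; first by rewrite eval_ringE.
by rewrite -[tpow _ _]/(tmul t (tpow t n)) !eval_ringE exprS -IH.
Qed.

Lemma eval_tsum s n f : @eval Lexp M s (tsum n f) = \sum_(i < n) (eval s (f i) : expcar M).
Proof.
rewrite -(big_mkord xpredT (fun i => eval s (f i) : expcar M)) /tsum /index_iota subn0.
elim: (iota 0 n) => [|i l IH]; first by rewrite eval_ringE big_nil.
by rewrite [foldr _ _ _]/= eval_ringE big_cons -IH.
Qed.

Definition poly2 d (a : nat -> nat -> expcar M) (c t : expcar M) : expcar M :=
  \sum_(i < d) (\sum_(j < d) a i j * rexp (c * t) ^+ j) * rexp t ^+ i.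

Lemma eval_tpoly2 s d :
  @eval Lexp M s (tpoly2 d) = poly2 d (fun i j => s (i * d + j).+2) (s 0%nat) (s 1%nat).
Proof.
have inner i : @eval Lexp M s (tsum d (fun j =>
      tmul (Var (i * d + j).+2) (tpow (texp (tmul (Var 0) (Var 1))) j))) =
    \sum_(j < d) s (i * d + j).+2 * rexp (s 0%nat * s 1%nat) ^+ j :> expcar M.
  by rewrite eval_tsum; apply: eq_bigr => j _; rewrite !eval_ringE eval_tpow !eval_ringE.
by rewrite /tpoly2 eval_tsum; apply: eq_bigr => i _; rewrite !eval_ringE eval_tpow inner.
Qed.

End Eval.

(** Kronecker's substitution: the i-th summand lives in the degrees from i m to (i + 1) m - 1, and
    these ranges are disjoint. *)
Lemma sum_shifted_poly_eq0 (A : comNzRingType) m d (q : nat -> {poly A}) :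
  (forall i, (size (q i) <= m)%nat) ->
  \sum_(i < d) q i * 'X^(i * m) = 0 -> forall i, (i < d)%nat -> q i = 0.
Proof.
elim: d q => // d IH q qm; rewrite big_ord_recl mul0n expr0 mulr1.
under eq_bigr => i _ do rewrite lift0 mulSn exprD mulrCA.
rewrite -mulr_sumr => E.
have q0 : q 0%nat = 0.
  apply/polyP => j; rewrite coef0; case: (ltnP j m) => [jm|mj]; last first.
    by rewrite nth_default // (leq_trans (qm _)).
  by move/polyP: E => /(_ j); rewrite coefD coefXnM jm addr0 coef0.
move: E; rewrite q0 add0r => E [//|i] id.
apply: (IH (fun i => q i.+1)) => //.
by apply/polyP => j; move/polyP: E => /(_ (m + j)%nat); rewrite coefXnM ltnNge leq_addr addKn !coef0.
Qed.

Section RealModel.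
Notation RM := (expcar real_exp_model).

Lemma real_natE n : (n%:R : RM) = INR n.
Proof. by elim: n => // n IH; rewrite mulrSr S_INR -IH. Qed.

Lemma real_powE (x : RM) n : x ^+ n = pow x n.
Proof. by elim: n => // n IH; rewrite exprS IH. Qed.

Lemma exp_pow (x : R) n : pow (exp x) n = exp (Rmult (INR n) x).
Proof.
elim: n => [|n IH]; first by rewrite Rmult_0_l exp_0.
by rewrite S_INR Rmult_plus_distr_r Rmult_1_l exp_plus -IH /= Rmult_comm.
Qed.

Lemma exp01_E (x : R) : Rle 0 x -> Rle x 1 -> exp01 x = exp x.
Proof. by move=> x0 x1; rewrite /exp01; case: Rle_dec => // ?; case: Rle_dec. Qed.

Lemma real_inv_nat n (c : RM) : n.+1%:R * c = 1 -> c = Rinv (INR n.+1).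
Proof.
move=> nc; have H : Rmult (INR n.+1) c = IZR 1 by rewrite -real_natE.
have n0 : INR n.+1 <> IZR 0 by exact: not_0_INR.
by apply: (Rmult_eq_reg_l (INR n.+1)) => //; rewrite H Rinv_r.
Qed.

Lemma INR_S_ge1 n : Rle 1 (INR n.+1).
Proof. by rewrite -[IZR 1]/(INR 1); apply: le_INR; apply/leP. Qed.

(** Both t and c t lie in [0, 1], where the restricted exponential is the true one. *)
Lemma real_rexp_scale n (c t : RM) : n.+1%:R * c = 1 -> Rle 0 t -> Rle t 1 ->
  rexp t = rexp (c * t) ^+ n.+1 /\ rexp (c * t) = exp (Rmult c t).
Proof.
move=> /real_inv_nat -> t0 t1; have n1 := INR_S_ge1 n.
have n0 : Rlt 0 (INR n.+1) by lra.
have i0 := Rinv_0_lt_compat _ n0.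
have i1 : Rle (Rinv (INR n.+1)) 1 by rewrite -Rinv_1; apply: Rinv_le_contravar => //; lra.
have E : rexp ((Rinv (INR n.+1) : RM) * t) = exp (Rmult (Rinv (INR n.+1)) t).
  have a0 : Rle 0 (Rmult (Rinv (INR n.+1)) t) by apply: Rmult_le_pos => //; lra.
  have a1 : Rle (Rmult (Rinv (INR n.+1)) t) 1 by nra.
  exact: exp01_E a0 a1.
split=> //; rewrite E real_powE exp_pow -Rmult_assoc Rinv_r ?Rmult_1_l; last lra.
exact: exp01_E.
Qed.

Lemma real_rexp_root n (c t : RM) : n.+1%:R * c = 1 ->
  rexp t = 0 \/ rexp t = rexp (c * t) ^+ n.+1.
Proof.
move=> nc; have [t0|t0] := pselect (Rle 0 t); last first.
  by left; rewrite -[LHS]/(exp01 t) /exp01; case: Rle_dec.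
have [t1|t1] := pselect (Rle t 1); last first.
  by left; rewrite -[LHS]/(exp01 t) /exp01; case: Rle_dec => // ?; case: Rle_dec.
by right; have [] := real_rexp_scale nc t0 t1.
Qed.

(* As rexp t = rexp (c * t) ^+ n.+1, this is a polynomial in rexp (c * t), and the monomials do
   not collide because d <= n.+1. *)
Lemma real_poly2_neq0 d n (a : nat -> nat -> RM) (c : RM) i j :
  (d <= n.+1)%nat -> n.+1%:R * c = 1 -> (i < d)%nat -> (j < d)%nat -> a i j != 0 ->
  exists t, poly2 d a c t <> 0.
Proof.
move=> dn nc id jd aij; apply: contrapT => /forallNP H.
have {}H t : poly2 d a c t = 0 by apply: contrapT; exact: H.
pose q i := \poly_(j < d) a i j.
suff P0 : \sum_(i < d) q i * 'X^(i * n.+1) = 0.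
  have qn k : (size (q k) <= n.+1)%nat by exact: leq_trans (size_poly _ _) dn.
  have qi := sum_shifted_poly_eq0 qn P0 id.
  by move/polyP: qi => /(_ j); rewrite coef_poly jd coef0 => /eqP; rewrite (negbTE aij).
set P := (\sum_(i < d) _); apply/eqP; apply: contrapT => /negP P0.
(* Infinitely many points of [0, 1]; injectivity of exp makes their images distinct roots of [P]. *)
pose t k : RM := Rinv (INR k.+1).
have t0 k : Rle 0 (t k) by apply/Rlt_le/Rinv_0_lt_compat; have := INR_S_ge1 k; lra.
have t1 k : Rle (t k) 1.
  by rewrite -Rinv_1; apply: Rinv_le_contravar; [lra|exact: INR_S_ge1].
pose u k := rexp (c * t k).
have uE k : u k = exp (Rmult c (t k)) by have [] := real_rexp_scale nc (t0 k) (t1 k).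
have Pu k : root P (u k).
  apply/rootP; rewrite -(H (t k)) /P horner_sum; apply: eq_bigr => l _.
  rewrite hornerM hornerXn horner_poly mulnC exprM /u.
  by have [<- _] := real_rexp_scale nc (t0 k) (t1 k).
have u_inj : injective u.
  move=> k l; rewrite !uE => /exp_inv; have c0 : c <> IZR 0.
    by rewrite (real_inv_nat nc); apply/Rinv_neq_0_compat/not_0_INR.
  move=> /(Rmult_eq_reg_l _ _ _) /(_ c0) /Rinv_eq_reg /INR_eq [].
  done.
have := max_poly_roots P0 (_ : all (root P) (map u (iota 0 (size P)))).
rewrite size_map size_iota ltnn map_inj_uniq ?iota_uniq // => /(_ _ isT) F.
suff: false by []. apply: F; apply/allP => x /mapP[k _ ->]; exact: Pu.
Qed.

End RealModel.
End Terms.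

(** * Transfer from the reals to all models *)

Section Transfer.
Import GRing.Theory.
Local Open Scope ring_scope.

Lemma expcar_natS_neq0 (M : exp_model) n : n.+1%:R != 0 :> expcar M.
Proof.
have H : holds Rexp_struct (Neg (Eq (tnat n.+1) tzero)).
  move=> s; rewrite !satE (@eval_tnat real_exp_model) (@eval_ringE real_exp_model) real_natE.
  exact: not_0_INR.
by apply/eqP; have := transfer (M := M) H (fun _ => 0 : expcar M); rewrite !satE eval_tnat eval_ringE.
Qed.

Lemma rexp_root (M : exp_model) n (c t : expcar M) : n.+1%:R * c = 1 ->
  rexp t = 0 \/ rexp t = rexp (c * t) ^+ n.+1.
Proof.
have H : holds Rexp_struct (Imp (Eq (tmul (tnat n.+1) (Var 0)) tone)
    (Or (Eq (texp (Var 1)) tzero)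
        (Eq (texp (Var 1)) (tpow (texp (tmul (Var 0) (Var 1))) n.+1)))).
  move=> s; rewrite !satE (@eval_tpow real_exp_model) !(@eval_ringE real_exp_model).
  rewrite (@eval_tnat real_exp_model) -mulrS.
  exact: real_rexp_root.
have := transfer (M := M) H (fun k => if k is 0%nat then c else t).
by rewrite !satE eval_tpow !eval_ringE eval_tnat -mulrS.
Qed.

(** The formula does not mention n, so that Los's theorem can carry it from the elements 1 / (n + 1)
    to the class of their sequence. *)
Definition poly2_neq0 d i j : formula Lexp :=
  Imp (Neg (Eq (Var (i * d + j).+2) tzero)) (Ex 1 (Neg (Eq (tpoly2 d) tzero))).

Lemma sat_poly2_neq0 (M : exp_model) (s : nat -> expcar M) d i j :
  @sat Lexp M s (poly2_neq0 d i j) <->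
  (s (i * d + j).+2 <> 0 ->
   exists t, poly2 d (fun i j => s (i * d + j).+2) (s 0%nat) t <> 0).
Proof.
rewrite /poly2_neq0 !satE !eval_ringE.
suff E t : @sat Lexp M (update s 1 t) (Neg (Eq (tpoly2 d) tzero)) <->
    poly2 d (fun i j => s (i * d + j).+2) (s 0%nat) t <> 0.
  by split=> H /H [t /E Ht]; exists t.
by rewrite !satE eval_ringE eval_tpoly2.
Qed.

Lemma poly2_neq0_transfer (M : exp_model) (s : nat -> expcar M) d n i j :
  (d <= n.+1)%nat -> (i < d)%nat -> (j < d)%nat -> n.+1%:R * s 0%nat = 1 ->
  @sat Lexp M s (poly2_neq0 d i j).
Proof.
move=> dn id jd sn.
have H : holds Rexp_struct (Imp (Eq (tmul (tnat n.+1) (Var 0)) tone) (poly2_neq0 d i j)).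
  move=> s'; rewrite sat_Imp sat_Eq !(@eval_ringE real_exp_model) (@eval_tnat real_exp_model) -mulrS => s'n.
  apply/(@sat_poly2_neq0 real_exp_model) => /eqP sij.
  exact: (@real_poly2_neq0 d n (fun i j => s' (i * d + j).+2) _ i j).
have := transfer (M := M) H s.
by rewrite sat_Imp sat_Eq !eval_ringE eval_tnat -mulrS; apply.
Qed.

Lemma eq_poly2 (M : exp_model) d (a b : nat -> nat -> expcar M) c t :
  (forall i j, (j < d)%nat -> a i j = b i j) -> poly2 d a c t = poly2 d b c t.
Proof.
move=> ab; apply: eq_bigr => i _; congr (_ * _); apply: eq_bigr => j _.
by rewrite ab.
Qed.

(** Division by d with remainder inverts the numbering i d + j of the coefficients, for j < d. *)
Definition coef_env (M : exp_model) d (a : nat -> nat -> expcar M) (c t : expcar M) (k : nat) :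
    expcar M :=
  match k with 0 => c | 1 => t | m.+2 => a (m %/ d)%nat (m %% d)%nat end.

Lemma coef_envE (M : exp_model) d (a : nat -> nat -> expcar M) c t i j :
  (j < d)%nat -> coef_env d a c t (i * d + j).+2 = a i j.
Proof.
move=> jd; rewrite /= divnMDl ?(leq_trans _ jd)// modnMDl.
by rewrite divn_small // modn_small // addn0.
Qed.

Lemma poly2_coef_env (M : exp_model) d (a : nat -> nat -> expcar M) c t u v :
  poly2 d (fun i j => coef_env d a c t (i * d + j).+2) u v = poly2 d a u v.
Proof. by apply: eq_poly2 => i j; exact: coef_envE. Qed.

End Transfer.

(** * Infinitesimal exponents *)

Notation TR := (TMd (L := Lexp) Fadd Fmul (Th Rexp_struct)).

Section Derivation.
Import GRing.Theory.
Local Open Scope ring_scope.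
Variables (M : structure (sigMd Lexp)) (MT : models M TR).

Definition red : exp_model := ExpModel (models_reduct MT).

Lemma eval_bin_add (s : nat -> M) t u :
  eval s (bin (L := Lexp) Fadd t u) = (eval s t : expcar red) + eval s u.
Proof.
congr (@ifun (sigMd Lexp) M (Some Fadd)); apply: funext => i.
by rewrite /pair2; case: ifP.
Qed.

Lemma eval_bin_mul (s : nat -> M) t u :
  eval s (bin (L := Lexp) Fmul t u) = (eval s t : expcar red) * eval s u.
Proof.
congr (@ifun (sigMd Lexp) M (Some Fmul)); apply: funext => i.
by rewrite /pair2; case: ifP.
Qed.

Lemma eval_dlt (s : nat -> M) t : eval s (dlt (L := Lexp) t) = delta (eval s t).
Proof. by []. Qed.

Lemma delta_add (x y : expcar red) : 
  delta (x + y : M) = (delta (x : M) : expcar red) + delta (y : M) :> expcar red.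
Proof.
have := MT (or_intror (or_intror (or_introl erefl))) (fun k => if k is 0%nat then x else y).
by rewrite /ax_add sat_Eq !(eval_dlt, eval_bin_add).
Qed.

Lemma delta_mul (x y : expcar red) :
  delta (x * y : M) = x * (delta (y : M) : expcar red) + y * (delta (x : M) : expcar red)
  :> expcar red.
Proof.
have := MT (or_intror (or_intror (or_intror erefl))) (fun k => if k is 0%nat then x else y).
by rewrite /ax_mul sat_Eq !(eval_dlt, eval_bin_add, eval_bin_mul).
Qed.

Lemma delta0 : delta (0 : expcar red) = 0 :> expcar red.
Proof. by have /eqP := delta_add 0 0; rewrite addr0 -subr_eq subrr => /eqP. Qed.

Lemma delta1 : delta (1 : expcar red) = 0 :> expcar red.
Proof. by have /eqP := delta_mul 1 1; rewrite mulr1 !mul1r -subr_eq subrr => /eqP. Qed.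

Lemma delta_exp_eq0 (x : expcar red) n :
  delta x = 0 :> expcar red -> delta (x ^+ n : expcar red) = 0 :> expcar red.
Proof.
move=> x0; elim: n => [|n IH]; first exact: delta1.
by rewrite exprS delta_mul IH x0 !mulr0 addr0.
Qed.

(* This property of c fails for c = 1 / n, but holds for suitable infinitesimal c. *)
Definition splits_exp (c : expcar red) : Prop := exists t : expcar red,
  delta (rexp (c * t)) = 0 :> expcar red /\ delta (rexp t) = 1 :> expcar red.

Lemma not_splits_exp n (c : expcar red) : n.+1%:R * c = 1 -> ~ splits_exp c.
Proof.
move=> nc [t [d0 d1]]; have := oner_neq0 (expcar red); rewrite -d1 => /eqP; apply.
have [->|->] := rexp_root t nc; first exact: delta0.
exact: delta_exp_eq0.
Qed.

Definition splits_exp_formula : formula (sigMd Lexp) :=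
  Ex 1 (And (Eq (dlt (temb (texp (tmul (Var 0) (Var 1))))) (temb tzero))
            (Eq (dlt (temb (texp (Var 1)))) (temb tone))).

Lemma sat_splits_exp (s : nat -> M) :
  sat s splits_exp_formula <-> splits_exp (s 0%nat : expcar red).
Proof.
suff E t : sat (update s 1 t) (And (Eq (dlt (temb (texp (tmul (Var 0) (Var 1))))) (temb tzero))
            (Eq (dlt (temb (texp (Var 1)))) (temb tone))) <->
    delta (rexp ((s 0%nat : expcar red) * t)) = 0 :> expcar red /\
    delta (rexp (t : expcar red)) = 1 :> expcar red.
  by split=> -[t /E Ht]; exists t.
rewrite !satE !eval_dlt !eval_temb.
by rewrite !(@eval_ringE red).
Qed.

End Derivation.

Section Embeddings.
Import GRing.Theory.
Local Open Scope ring_scope.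
Variables (M N : structure (sigMd Lexp)) (MT : models M TR) (NT : models N TR).
Variables (h : M -> N) (emb : embedding h).

Definition field_map : expcar (red MT) -> expcar (red NT) := h.

Lemma embedding_add : {morph field_map : x y / x + y}.
Proof.
move=> x y; have := embedding_eval emb (fun k => if k is 0%nat then x else y)
  (bin (L := Lexp) Fadd (Var 0) (Var 1)).
by rewrite (eval_bin_add MT) (eval_bin_add NT).
Qed.

Lemma embedding_mul : {morph field_map : x y / x * y}.
Proof.
move=> x y; have := embedding_eval emb (fun k => if k is 0%nat then x else y)
  (bin (L := Lexp) Fmul (Var 0) (Var 1)).
by rewrite (eval_bin_mul MT) (eval_bin_mul NT).
Qed.

Lemma embedding0 : field_map 0 = 0.
Proof. by have /eqP := embedding_add 0 0; rewrite addr0 -subr_eq subrr => /eqP. Qed.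

Lemma embedding1 : field_map 1 = 1.
Proof.
have := embedding_eval emb (fun _ => (0 : expcar (red MT)) : M) (temb tone).
by rewrite !eval_temb (@eval_ringE (red MT)) (@eval_ringE (red NT)).
Qed.

Lemma embedding_sub : {morph field_map : x y / x - y}.
Proof. by move=> x y; apply/eqP; rewrite eq_sym subr_eq -embedding_add subrK. Qed.

Definition delta_graph : set (dual (expcar (red NT))) :=
  [set a | exists x : expcar (red MT), a = (field_map x, field_map (delta (x : M)))].

Lemma delta_graphP : derivation_graph delta_graph.
Proof.
split.
- by exists 1; rewrite (delta1 MT) embedding1 embedding0.
- move=> _ _ [x ->] [y ->]; exists (x - y); rewrite embedding_sub.
  congr pair; rewrite -[LHS]embedding_sub; congr field_map.
  by have := delta_add (x - y) y; rewrite subrK => ->; rewrite addrK.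
- move=> _ _ [x ->] [y ->]; exists (x * y); rewrite embedding_mul.
  by congr pair; rewrite delta_mul embedding_add !embedding_mul.
- move=> _ [x ->] /= hx; have -> : x = 0.
    by case: emb => hi _; apply: hi; rewrite -[RHS]/(field_map 0) embedding0.
  by rewrite (delta0 MT) embedding0.
Qed.

End Embeddings.

Section Diagonal.
Variables (L : signature) (I : Type) (V : set_system I) (VV : UltraFilter V) (N : structure L).

Definition diag (x : N) : up V (fun _ => N) := cls V (fun _ => x).

Lemma diag_embedding : embedding diag.
Proof.
split=> [x y /(clsP VV) Hxy|]; first by have [] := filter_ex Hxy.
split=> [f a|r a]; first exact: esym (ifun_up VV (fun k _ => a k)).
apply: iff_trans (iff_sym (irel_up VV (fun k _ => a k))).
split=> [ra|ra]; first by apply: filterS filterT.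
by have [] := filter_ex ra.
Qed.

End Diagonal.

(** * Splitting of exponentials in existentially closed models *)

Section ExistentiallyClosedModel.
Import GRing.Theory.
Local Open Scope ring_scope.
Variables (N : structure (sigMd Lexp)) (Nec : ec_model TR N).
Let NT : models N TR := Nec.1.
Let K := expcar (red NT).
Variable c : K.
Hypothesis c_generic : forall d (a : nat -> nat -> K) i j,
  (i < d)%nat -> (j < d)%nat -> a i j != 0 -> exists t, poly2 d a c t <> 0.

(** The inner variable is exp (c t), the outer one exp t. Unlike the coefficient families of
    [poly2], these polynomials come with a product. *)
Let eval2 (Q : {poly {poly K}}) (t : K) : K := Q.[(rexp t)%:P].[rexp (c * t)].

Lemma horner_poly2 (Q : {poly {poly K}}) d t : (size Q <= d)%nat ->
  (forall i, (size (Q`_i)%R <= d)%nat) -> eval2 Q t = poly2 d (fun i j => Q`_i`_j) c t.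
Proof.
move=> Qd Qid; rewrite /eval2 (horner_coef_wide _ Qd) horner_sum.
apply: eq_bigr => i _; rewrite hornerM horner_exp hornerC.
by rewrite (horner_coef_wide _ (Qid i)).
Qed.

Let nonvanishing (Q : {poly {poly K}}) : set N := [set t | eval2 Q t <> 0].

Lemma nonvanishing_neq0 Q : Q != 0 -> nonvanishing Q !=set0.
Proof.
move=> Q0; pose d := maxn (size Q) (\max_(i < size Q) size (Q`_i)%R).
have Qd : (size Q <= d)%nat by exact: leq_maxl.
have Qid i : (size (Q`_i)%R <= d)%nat.
  case: (ltnP i (size Q)) => [iQ|Qi]; last by rewrite nth_default // size_poly0.
  apply: leq_trans (leq_maxr _ _).
  exact: (@leq_bigmax _ (fun i : 'I_(size Q) => size (Q`_i)) (Ordinal iQ)).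
have Q1 : Q`_(size Q).-1 != 0 by rewrite -lead_coefE lead_coef_eq0.
have Q2 : Q`_(size Q).-1`_(size Q`_(size Q).-1).-1 != 0 by rewrite -lead_coefE lead_coef_eq0.
have S0 (p : nzSemiRingType) (q : {poly p}) : q != 0 -> ((size q).-1 < size q)%nat.
  by rewrite -size_poly_gt0 => q0; rewrite prednK.
have [t] := @c_generic d (fun i j => Q`_i`_j) _ _ (leq_trans (S0 _ _ Q0) Qd)
  (leq_trans (S0 _ _ Q1) (Qid _)) Q2.
by rewrite -horner_poly2 //; exists t.
Qed.

(** Where P Q does not vanish, neither factor does; and no set is empty, by the genericity of c. *)
Lemma nonvanishing_filter : ProperFilter (filter_from [set Q | Q != 0] nonvanishing).
Proof.
apply: filter_from_proper; last exact: nonvanishing_neq0.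
apply: filter_from_filter; first by exists 1; exact: oner_neq0.
move=> P Q P0 Q0; exists (P * Q); first by rewrite /= mulf_neq0.
move=> t; rewrite /nonvanishing /eval2 /= !hornerM => /eqP.
by rewrite mulf_eq0 negb_or => /andP[/eqP ? /eqP ?].
Qed.

Let V : set_system N := sval (cid (ultraFilterLemma nonvanishing_filter)).

Let VV : UltraFilter V.
Proof. by have [] := svalP (cid (ultraFilterLemma nonvanishing_filter)). Qed.

Lemma nonvanishing_V Q : Q != 0 -> V (nonvanishing Q).
Proof.
have [_ sub] := svalP (cid (ultraFilterLemma nonvanishing_filter)).
by move=> Q0; apply: sub; exists Q.
Qed.

Let N' : structure (sigMd Lexp) := up V (fun _ => N).

Lemma ultrapower_models : models N' TR.
Proof. by apply: (@up_models _ _ _ VV) => _; exact: NT. Qed.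

Let F := expcar (red ultrapower_models).
Let dg : K -> F := @diag _ _ V N.
(** The index set is [N] itself, and the class of the identity has the properties shared by
    [V]-almost all t in [N]. *)
Let tstar : F := @cls _ _ V (fun _ => N) (fun t => t).

Lemma poly2_ultrapower n (a : nat -> nat -> K) :
  poly2 n (fun i j => dg (a i j)) (dg c) tstar = 0 ->
  V [set t | poly2 n a c t = 0].
Proof.
move=> E; pose f m (t : N) : N := coef_env n a c (t : K) m.
pose p := Eq (tpoly2 n) tzero.
have : sat (fun m => @cls _ _ V (fun _ => N) (f m) : N') (femb p).
  apply/sat_femb; rewrite sat_Eq (@eval_tpoly2 (red ultrapower_models)).
  rewrite (@eval_ringE (red ultrapower_models)) -[RHS]E.
  apply: (@eq_poly2 (red ultrapower_models) n) => i j jn.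
  by congr (@cls _ _ V _ _); apply: funext => t; rewrite /f coef_envE.
have V_ultra : UltraFilter V := VV.
move/(los VV); apply: filterS => t /sat_femb.
rewrite sat_Eq (@eval_tpoly2 (red NT)) (@eval_ringE (red NT)).
by rewrite /f poly2_coef_env.
Qed.

Let emb : embedding (@diag _ _ V N) := diag_embedding VV N.

(** By Los's theorem, a relation over [N] at [tstar] holds at [V]-almost all t, whereas a nonzero
    polynomial is nonvanishing on a set of [V]. *)
Lemma tstar_independent : independent_over (@delta_graph N N' NT ultrapower_models (@diag _ _ V N))
  (rexp (dg c * tstar)) (rexp tstar).
Proof.
move=> n a Da E i j iln jln.
have /choice [k kP] : forall i, exists k : nat -> K, forall j, a i j = (dg (k j), dg (delta (k j : N))).
  by move=> i'; have /choice [k kP] := Da i'; exists k.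
have : k i j = 0.
  apply/eqP; apply: contrapT => /negP kij.
  pose Q : {poly {poly K}} := \poly_(i < n) \poly_(j < n) k i j.
  have Q0 : Q != 0.
    apply: contra_neq kij => Q0; have : Q`_i`_j = 0 by rewrite Q0 !coef0.
    by rewrite coef_poly iln coef_poly jln.
  have V_ultra : UltraFilter V := VV.
  have : V [set t | poly2 n k c t = 0].
    apply: poly2_ultrapower; rewrite -[RHS]E.
    apply: eq_bigr => i' _; congr (_ * _); apply: eq_bigr => j' _.
    by rewrite kP.
  move=> H; have [t [/= t0]] := filter_ex (filterI H (nonvanishing_V Q0)).
  apply; rewrite (@horner_poly2 _ n) ?size_poly // => [|i'].
    rewrite -[RHS]t0; apply: eq_bigr => i' _; congr (_ * _); apply: eq_bigr => j' _.
    by rewrite coef_poly ltn_ord coef_poly ltn_ord.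
  by rewrite coef_poly; case: ifP => _; rewrite ?size_poly0 ?size_poly.
rewrite kP => ->; rewrite (delta0 NT).
by have := @embedding0 N N' NT ultrapower_models _ emb; rewrite -[dg 0]/(@field_map N N' NT ultrapower_models (@diag _ _ V N) 0) => ->.
Qed.

Theorem ec_splits_exp : @splits_exp N NT c.
Proof.
have char0 := @expcar_natS_neq0 (red ultrapower_models).
have [d [dD dM dE d0 d1]] := graph_extension_independent char0 0 1
  (@delta_graphP N N' NT ultrapower_models _ emb) tstar_independent.
(* Only the derivation of the ultrapower is replaced. The Morley relations concern formulas without
   it, and d extends the derivation of [N], so the diagonal remains an embedding. *)
pose N'' : structure (sigMd Lexp) := @expand Lexp (reduct N') d.
have dltE (s : nat -> N'') t : eval s (dlt (L := Lexp) t) = d (eval s t) by [].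
have addE (s : nat -> N'') t u :
    eval s (bin (L := Lexp) Fadd t u) = (eval s t : F) + (eval s u : F).
  by congr (@ifun (sigMd Lexp) N'' (Some Fadd)); apply: funext => i; rewrite /pair2; case: ifP.
have mulE (s : nat -> N'') t u :
    eval s (bin (L := Lexp) Fmul t u) = (eval s t : F) * (eval s u : F).
  by congr (@ifun (sigMd Lexp) N'' (Some Fmul)); apply: funext => i; rewrite /pair2; case: ifP.
have N''T : models N'' TR.
  apply: models_expand.
  - exact: models_reduct ultrapower_models.
  - by move=> s; rewrite /ax_add sat_Eq !(dltE, addE); exact: dD.
  - by move=> s; rewrite /ax_mul sat_Eq !(dltE, addE, mulE); exact: dM.
have emb'' : @embedding (sigMd Lexp) N N'' (@diag _ _ V N).
  have [hi [hf hr]] := emb; split=> //; split=> [[f|] a|[r|p] a].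
  - exact: (hf (Some f)).
  - have -> : a = (fun _ => a ord0) by apply: funext => i; rewrite (ord1 i).
    by have /esym := dE _ (ex_intro _ (a ord0 : K) erefl).
  - exact: (hr (inl r)).
  - exact: iff_trans (hr (inr p) a) (morley_relE (dg c : N') _ ultrapower_models).
have := Nec.2 N'' _ emb'' N''T splits_exp_formula (fun _ => c) isT.
move=> /(_ _)/(sat_splits_exp NT); apply; apply/(sat_splits_exp N''T).
by exists tstar.
Qed.

End ExistentiallyClosedModel.

(** * An existentially closed model and the final contradiction *)

Definition Lexp_fun_code (f : Lexp_fun) : nat :=
  match f with Fzero => 0 | Fone => 1 | Fadd => 2 | Fneg => 3 | Fmul => 4 | Fexp => 5 end.

Lemma Lexp_fun_code_inj : injective Lexp_fun_code.
Proof. by do 2!case. Qed.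

Definition Lexp_rel_code (r : Lexp_rel) : nat := 0.

Lemma Lexp_rel_code_inj : injective Lexp_rel_code.
Proof. by do 2!case. Qed.

Lemma ec_TR_exists : exists M, ec_model TR M.
Proof.
(* The reals with the zero derivation start the construction. *)
pose N0 := @expand Lexp Rexp_struct (fun _ => IZR 0).
have N0T : models N0 TR.
  apply: models_expand => [p //|s|s]; rewrite ?/ax_add ?/ax_mul sat_Eq /=.
    by rewrite Rplus_0_l.
  by rewrite !Rmult_0_r Rplus_0_l.
have code_inj := formula_code_inj
  (fsymMd_code_inj (L := Lexp) Lexp_fun_code_inj)
  (rsymMd_code_inj (L := Lexp) Lexp_fun_code_inj Lexp_rel_code_inj).
apply: (@ec_model_exists (sigMd Lexp) TR N0 (IZR 0) N0T _ code_inj).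
move=> P M h; exact: TMd_closed.
Qed.

Theorem theorem3p3 :
  ~ admits_generic_derivations (L := Lexp) Fadd Fmul (Th Rexp_struct).
Proof.
move=> [Sigma SigmaP]; have [M Mec] := ec_TR_exists; have MT := Mec.1.
have [U [UU oo_U]] := ultraFilterLemma eventually_filter.
pose N : structure (sigMd Lexp) := up U (fun _ => M).
have Nec : ec_model TR N.
  by apply/SigmaP; apply: (@up_models _ _ _ UU) => _; apply/SigmaP.
pose ci n : expcar (red MT) := (n.+1%:R^-1)%R.
have ciP n : (n.+1%:R * ci n = 1)%R.
  by apply: GRing.divff; exact: expcar_natS_neq0.
pose c : expcar (red Nec.1) := cls U ci.
have : splits_exp c.
  apply: ec_splits_exp => d a i j id jd aij.
  pose s := coef_env d a c 0%R.
  (* Variable 0 keeps the representative [ci], which is 1 / (n + 1) at every index n; a chosen one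
     would be so only almost everywhere. *)
  pose f m : nat -> M := if m is 0 then ci else rep (s m : N).
  have sf : (s : nat -> N) = (fun m => cls U (f m)).
    by apply: funext => -[//|m]; rewrite [RHS]repK.
  have : sat (s : nat -> N) (femb (poly2_neq0 d i j)).
    (* From index d on, n + 1 is large enough for the degree bound d. *)
    rewrite sf; apply/(los UU); apply: oo_U; exists d => // n dn.
    apply/(sat_femb (N := M)); apply: (@poly2_neq0_transfer (red MT) _ d n) => //.
    exact: leq_trans dn _.
  move=> /sat_femb/(@sat_poly2_neq0 (red Nec.1)).
  rewrite /s coef_envE // => /(_ (elimN eqP aij)) [t].
  by rewrite poly2_coef_env; exists t.
move=> /(@sat_splits_exp _ Nec.1 (fun _ => c)) /(los UU) H.
have [n /(@sat_splits_exp _ MT)] := filter_ex H.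
exact: not_splits_exp (ciP n).
Qed.
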